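(* There exist positive integers $n_0$ and $m_0$ such that for all integers $n\ge n_0$ there exist a fan $\tilde\Sigma'$ subdividing $\tilde\Sigma$ and an integral piecewise linear function $\tilde h$ on $\tilde\Sigma'$ such that $\tilde\Sigma',\tilde h$ is good for $\Sigma',\ m_0h+n\varphi$.
   Context: **Nef-partitions.** $M$ is a free abelian group of finite rank, $N=\mathrm{Hom}(M,\mathbb Z)$, $M_{\mathbb R}=M\otimes\mathbb R$, $N_{\mathbb R}=N\otimes\mathbb R$. $\Delta\subseteq M_{\mathbb R}$ is a reflexive polytope with dual $\Delta^*=\{y\mid\langle x,y\rangle\ge-1\ \forall x\in\Delta\}$; $\Sigma$ is the (inner) normal fan of $\Delta$ in $N_{\mathbb R}$ (cones over proper faces of $\Delta^*$), $\Sigma(1)$ the primitive generators of its rays, $\varphi$ the $\Sigma$-piecewise linear function with value $1$ on $\Sigma(1)$. $\Delta=\Delta_1+\cdots+\Delta_r$ is a Minkowski decomposition into lattice polytopes which is a nef-partition: with $\varphi_i(y)=-\inf_{x\in\Delta_i}\langle x,y\rangle$ (so $\varphi=\sum\varphi_i$), $\varphi_i(e)\in\{0,1\}$ for $e\in\Sigma(1)$. $\nabla_i=\mathrm{Conv}(\{0\}\cup\{e\in\Sigma(1)\mid\varphi_i(e)=1\})$, $\nabla=\sum\nabla_i$, reflexive with dual $\nabla^*=\mathrm{Conv}(\Delta_1,\ldots,\Delta_r)$; $\check\Sigma$ is the normal fan of $\nabla$ in $M_{\mathbb R}$, $\check\varphi_i(x)=-\inf_{y\in\nabla_i}\langle x,y\rangle$,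 $\check\varphi=\sum\check\varphi_i$. **Extra data.** Convex means $g(x+y)\le g(x)+g(y)$; strictly convex on a fan means convex with the maximal cones exactly the maximal domains of linearity. Fix subdivisions $\Sigma'$ of $\Sigma$, $\check\Sigma'$ of $\check\Sigma$ giving partial crepant resolutions (rays generated by lattice points of $\partial\Delta^*$, resp. $\partial\nabla^*$), and integral piecewise linear functions $h$ on $N_{\mathbb R}$, $\check h$ on $M_{\mathbb R}$, strictly convex on $\Sigma'$, resp. $\check\Sigma'$, with $h'=h-\varphi$, $\check h'=\check h-\check\varphi$ convex. $\nabla^{\check h'}=\{y\in N_{\mathbb R}\mid\langle x,y\rangle\ge-\check h'(x)\ \forall x\in M_{\mathbb R}\}$. **Good data.** $\tilde\Delta_i=\{(m,l)\in M_{\mathbb R}\oplus\mathbb R\mid m\in\Delta_i,\ l\ge\check h'(m)\}$, $\tilde\Delta=\sum\tilde\Delta_i$, $\tilde\Sigma$ its normal fan in $N_{\mathbb R}\oplus\mathbb R$, $\tilde\varphi(\tilde n)=-\inf_{\tilde m\in\tilde\Delta}\langle\tilde n,\tilde m\rangle$. A subdivision $\tilde\Sigma'$ of $\tilde\Sigma$ is good for $\Sigma'$ if $\{\sigma\cap(N_{\mathbb R}\times\{0\})\mid\sigma\in\tilde\Sigma'\}=\Sigma'$ and every ray of $\tilde\Sigma'$ not in $N_{\mathbb R}\times\{0\}$ is generated by a primitive $(n,1)$ with $n\in\nabla^{\check h'}$. For an integral piecewise linear function $g$ on $\Sigma'$, strictly convex on $\Sigma'$ and with $g-\varphi$ convex,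 $\tilde\Sigma'$ with an integral piecewise linear function $\tilde h$ on it is *good for $\Sigma',g$* if $\tilde\Sigma'$ is good for $\Sigma'$, $\tilde h|_{N_{\mathbb R}\times\{0\}}=g$, $\tilde h$ is strictly convex on $\tilde\Sigma'$, and $\tilde h-\tilde\varphi$ is convex on $\tilde\Sigma'$. *)

(* Defs.v *)
From HB Require Import structures.
From mathcomp Require Import all_boot all_order all_algebra.
From mathcomp Require Import all_classical all_reals all_analysis.

Set Implicit Arguments.
Unset Strict Implicit.
Unset Printing Implicit Defensive.

Import Order.TTheory GRing.Theory Num.Theory.
Import numFieldNormedType.Exports.

Local Open Scope classical_set_scope.
Local Open Scope ring_scope.

(* A basis of M is fixed, so M = N = Z^d,
   M_R and N_R are both 'rV[R]_d, and the pairing between them is the standard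
   one; N_R (+) R and M_R (+) R are 'rV[R]_(d + 1), the last coordinate being
   the extra one. *)

Section Polyhedra.
Context {R : realType}.

Definition pairing {d} (x y : 'rV[R]_d) : R := \sum_i x 0 i * y 0 i.

Definition lattice {d} : set 'rV[R]_d := [set x | forall i, x 0 i \is a Num.int].

Definition primitive {d} (e : 'rV[R]_d) : Prop :=
  [/\ lattice e, e <> 0 &
      forall (k : nat) (u : 'rV[R]_d), lattice u -> e = u *+ k -> k = 1%N].

Definition conv_hull {d} (A : set 'rV[R]_d) : set 'rV[R]_d :=
  [set x | exists (k : nat) (p : 'I_k -> 'rV[R]_d) (w : 'I_k -> R),
     [/\ forall i, A (p i), forall i, 0 <= w i, \sum_i w i = 1 &
         x = \sum_i w i *: p i]].

Definition minkowski_sum {d r} (A : 'I_r -> set 'rV[R]_d) : set 'rV[R]_d :=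
  [set x | exists p : 'I_r -> 'rV[R]_d,
     (forall i, A i (p i)) /\ x = \sum_i p i].

Definition lattice_polytope {d} (P : set 'rV[R]_d) : Prop :=
  exists A : set 'rV[R]_d, [/\ finite_set A, A `<=` lattice & P = conv_hull A].

Definition polar {d} (P : set 'rV[R]_d) : set 'rV[R]_d :=
  [set y | forall x, P x -> -1 <= pairing x y].

Definition reflexive_polytope {d} (P : set 'rV[R]_d) : Prop :=
  [/\ lattice_polytope P, interior P 0 & lattice_polytope (polar P)].

(* [inf] is the real infimum, with a default value when it does not exist; below
   it is only used where x |-> <x, y> is bounded below on the nonempty set P. *)
Definition support_fun {d} (P : set 'rV[R]_d) (y : 'rV[R]_d) : R :=
  - inf [set pairing x y | x in P].

Definition ray {d} (e : 'rV[R]_d) : set 'rV[R]_d :=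
  [set x | exists2 t : R, 0 <= t & x = t *: e].

Definition is_ray {d} (C : set 'rV[R]_d) : Prop :=
  exists2 e : 'rV[R]_d, e <> 0 & C = ray e.

Definition rational_cone {d} (C : set 'rV[R]_d) : Prop :=
  exists (k : nat) (p : 'I_k -> 'rV[R]_d),
    (forall i, lattice (p i)) /\
    C = [set x | exists2 a : 'I_k -> R,
                   (forall i, 0 <= a i) & x = \sum_i a i *: p i].

Definition strongly_convex {d} (C : set 'rV[R]_d) : Prop :=
  forall x, C x -> C (- x) -> x = 0.

Definition cone_face {d} (F C : set 'rV[R]_d) : Prop :=
  exists m : 'rV[R]_d,
    (forall x, C x -> 0 <= pairing m x) /\ F = C `&` [set x | pairing m x = 0].

Definition is_fan {d} (S : set (set 'rV[R]_d)) : Prop :=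
  [/\ finite_set S,
      S !=set0,
      forall C, S C -> rational_cone C /\ strongly_convex C,
      forall C F, S C -> cone_face F C -> S F &
      forall C1 C2, S C1 -> S C2 ->
        cone_face (C1 `&` C2) C1 /\ cone_face (C1 `&` C2) C2].

Definition fan_support {d} (S : set (set 'rV[R]_d)) : set 'rV[R]_d :=
  [set x | exists2 C, S C & C x].

Definition subdivides {d} (S' S : set (set 'rV[R]_d)) : Prop :=
  [/\ is_fan S', fan_support S' = fan_support S &
      forall C', S' C' -> exists2 C, S C & C' `<=` C].

Definition ray_generators {d} (S : set (set 'rV[R]_d)) : set 'rV[R]_d :=
  [set e | primitive e /\ S (ray e)].

Definition polyhedron_face {d} (P : set 'rV[R]_d) (y : 'rV[R]_d) :
    set 'rV[R]_d :=
  [set x | P x /\ forall x', P x' -> pairing x y <= pairing x' y].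

Definition normal_cone {d} (P F : set 'rV[R]_d) : set 'rV[R]_d :=
  [set y | F `<=` polyhedron_face P y].

(* Inner normal fan.  P may be an unbounded polyhedron; the support is then the
   set of y for which x |-> <x, y> attains a minimum on P. *)
Definition normal_fan {d} (P : set 'rV[R]_d) : set (set 'rV[R]_d) :=
  [set C | exists y, polyhedron_face P y !=set0 /\
                     C = normal_cone P (polyhedron_face P y)].

Definition piecewise_linear {d} (S : set (set 'rV[R]_d)) (g : 'rV[R]_d -> R) :
    Prop :=
  forall C, S C -> exists m : 'rV[R]_d, forall x, C x -> g x = pairing m x.

Definition integral_piecewise_linear {d} (S : set (set 'rV[R]_d))
    (g : 'rV[R]_d -> R) : Prop :=
  forall C, S C ->
    exists2 m : 'rV[R]_d, lattice m & forall x, C x -> g x = pairing m x.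

Definition convex_on {d} (A : set 'rV[R]_d) (g : 'rV[R]_d -> R) : Prop :=
  forall x y, A x -> A y -> g (x + y) <= g x + g y.

Definition convex_cone {d} (D : set 'rV[R]_d) : Prop :=
  [/\ D 0, forall x y, D x -> D y -> D (x + y) &
      forall (t : R) x, 0 <= t -> D x -> D (t *: x)].

Definition linearity_domain {d} (A : set 'rV[R]_d) (g : 'rV[R]_d -> R)
    (D : set 'rV[R]_d) : Prop :=
  [/\ convex_cone D, D `<=` A &
      exists m : 'rV[R]_d, forall x, D x -> g x = pairing m x].

Definition maximal_for {T} (P : set T -> Prop) (D : set T) : Prop :=
  P D /\ forall D', P D' -> D `<=` D' -> D' = D.

Definition strictly_convex {d} (S : set (set 'rV[R]_d)) (g : 'rV[R]_d -> R) :
    Prop :=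
  convex_on (fan_support S) g /\
  forall D, maximal_for S D <->
            maximal_for (linearity_domain (fan_support S) g) D.

End Polyhedra.

Section NefPartition.
Context {R : realType}.

Definition nef_partition {d r} (Delta : set 'rV[R]_d)
    (D : 'I_r -> set 'rV[R]_d) : Prop :=
  [/\ forall i, lattice_polytope (D i),
      Delta = minkowski_sum D &
      forall i e, ray_generators (normal_fan Delta) e ->
        support_fun (D i) e = 0 \/ support_fun (D i) e = 1].

Definition nabla_part {d r} (Delta : set 'rV[R]_d) (D : 'I_r -> set 'rV[R]_d)
    (i : 'I_r) : set 'rV[R]_d :=
  conv_hull ([set 0] `|`
    [set e | ray_generators (normal_fan Delta) e /\ support_fun (D i) e = 1]).

Definition nabla {d r} (Delta : set 'rV[R]_d) (D : 'I_r -> set 'rV[R]_d) :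
    set 'rV[R]_d :=
  minkowski_sum (nabla_part Delta D).

Definition check_phi {d r} (Delta : set 'rV[R]_d) (D : 'I_r -> set 'rV[R]_d)
    (x : 'rV[R]_d) : R :=
  \sum_i support_fun (nabla_part Delta D i) x.

(* S' subdivides S, and its rays are generated by lattice points of the
   boundary of the (closed) polytope Q. *)
Definition partial_crepant_resolution {d} (Q : set 'rV[R]_d)
    (S S' : set (set 'rV[R]_d)) : Prop :=
  subdivides S' S /\
  forall C, S' C -> is_ray C ->
    exists p : 'rV[R]_d, [/\ lattice p, (Q `\` interior Q) p & C = ray p].

Definition nabla_twisted {d} (hc' : 'rV[R]_d -> R) : set 'rV[R]_d :=
  [set y | forall x, - hc' x <= pairing x y].

End NefPartition.

Section GoodData.
Context {R : realType}.

Definition extend {d} (x : 'rV[R]_d) (l : R) : 'rV[R]_(d + 1) :=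
  row_mx x (const_mx l).

Definition tilde_part {d r} (D : 'I_r -> set 'rV[R]_d) (hc' : 'rV[R]_d -> R)
    (i : 'I_r) : set 'rV[R]_(d + 1) :=
  [set x | exists m l, [/\ D i m, hc' m <= l & x = extend m l]].

Definition tilde_Delta {d r} (D : 'I_r -> set 'rV[R]_d)
    (hc' : 'rV[R]_d -> R) : set 'rV[R]_(d + 1) :=
  minkowski_sum (tilde_part D hc').

Definition level0 {d} : set 'rV[R]_(d + 1) := range (fun y : 'rV[R]_d => extend y 0).

(* The intersection with N_R x {0}, viewed in N_R. *)
Definition slice0 {d} (C : set 'rV[R]_(d + 1)) : set 'rV[R]_d :=
  [set y | C (extend y 0)].

Definition good_fan {d r} (D : 'I_r -> set 'rV[R]_d) (hc' : 'rV[R]_d -> R)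
    (S' : set (set 'rV[R]_d)) (tS' : set (set 'rV[R]_(d + 1))) : Prop :=
  [/\ subdivides tS' (normal_fan (tilde_Delta D hc')),
      [set slice0 C | C in tS'] = S' &
      forall C, tS' C -> is_ray C -> ~ C `<=` level0 ->
        exists n : 'rV[R]_d,
          [/\ primitive (extend n 1), nabla_twisted hc' n &
              C = ray (extend n 1)]].

(* The functions g for which "good for S', g" is meaningful. *)
Definition admissible {d} (phi : 'rV[R]_d -> R) (S' : set (set 'rV[R]_d))
    (g : 'rV[R]_d -> R) : Prop :=
  [/\ integral_piecewise_linear S' g,
      strictly_convex S' g &
      convex_on setT (g \- phi)].

Definition good_data {d r} (D : 'I_r -> set 'rV[R]_d) (hc' : 'rV[R]_d -> R)
    (phi : 'rV[R]_d -> R) (S' : set (set 'rV[R]_d)) (g : 'rV[R]_d -> R)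
    (tS' : set (set 'rV[R]_(d + 1))) (th : 'rV[R]_(d + 1) -> R) : Prop :=
  admissible phi S' g /\
  [/\ good_fan D hc' S' tS',
      integral_piecewise_linear tS' th,
      forall y, th (extend y 0) = g y,
      strictly_convex tS' th &
      convex_on (fan_support tS') (th \- support_fun (tilde_Delta D hc'))].

End GoodData.

(* Main.v *)
Require Import Defs.
From HB Require Import structures.
From mathcomp Require Import all_boot all_order all_algebra.
From mathcomp Require Import all_classical all_reals all_analysis.
From mathcomp Require Import ring lra.

Set Implicit Arguments.
Unset Strict Implicit.
Unset Printing Implicit Defensive.

Import Order.TTheory GRing.Theory Num.Theory.
Import numFieldNormedType.Exports.

Local Open Scope classical_set_scope.
Local Open Scope ring_scope.

(** The fan and the function are obtained together from a linear program. The
    function is the support function of a polyhedron [polyh G c], whose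
    inequalities are indexed by a finite set [G] of allowed ray generators
    with costs [c]. The normal fan of such a polyhedron consists of the cones
    spanned by the inequalities active at its points ([act_fan]): its rays are
    generated by elements of [G], it is a fan as soon as the polyhedron has a
    strictly interior point, and linear programming duality ([lp_duality],
    derived from Weyl's theorem [weyl]) shows that it fills the cone over [G]
    and that the support function is strictly convex on it
    ([act_cone_exposed], [exposed_strictly_convex]).

    The set [G] consists of the vectors [(e, 0)], for [e] the ray generators
    of [Sigma'], and [(v, 1)], for [v] the vertices of the twisted polytope.
    The first point is that [tilde_Delta] itself is of this form, with cost
    one at height zero and cost zero at height one. For this it must be the
    epigraph over [Delta] of the twisted function [ch - check_phi]
    ([tilde_Delta_epigraph]). A point [m] of [Delta] lies in a cone of
    [cSigma'], whose ray generators are distributed among the parts [D i] of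
    the nef-partition ([polar_nabla_color]); collecting the terms of [m] part
    by part decomposes [m] into points [p i] of [D i] lying in one cone, where
    the twisted function is additive ([twisted_decomposition]). The same
    argument shows that [tilde_Delta] is a lattice polyhedron
    ([tilde_Delta_lattice_face]).

    Now take the cost [m0 h + n] at height zero and zero at height one. The
    part of the resulting fan at height zero is the fan of [m0 h + n phi],
    that is [Sigma'] ([slice0_act_fan], [complete_fan_act_fan]). For large [n]
    the linear program is lexicographic: first minimise the cost of
    [tilde_Delta], then [m0 h] ([lexicographic_uniform]). Hence its optima are
    the points [n x + w], with [x] a lattice point of [tilde_Delta] and [w]
    coming from finitely many rational points, which [m0] clears of
    denominators; this gives integrality, and shows that each cone lies in a
    cone of the normal fan of [tilde_Delta] ([combine_cone]). Finally the
    functions for [n] and [n - 1] differ by the support function of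
    [tilde_Delta], so subtracting that function leaves the convex function for
    [n - 1] ([combine_convex]). *)

(** * The pairing, the lattice and the extra coordinate *)

Section Pairing.
Context {R : realType} {d : nat}.
Implicit Types (x y z : 'rV[R]_d) (t : R).

Lemma pairingC x y : pairing x y = pairing y x.
Proof. by apply: eq_bigr => i _; rewrite mulrC. Qed.

Lemma pairingDl x y z : pairing (x + y) z = pairing x z + pairing y z.
Proof. by rewrite -big_split; apply: eq_bigr => i _; rewrite mxE mulrDl. Qed.

Lemma pairingZl t x y : pairing (t *: x) y = t * pairing x y.
Proof. by rewrite mulr_sumr; apply: eq_bigr => i _; rewrite mxE mulrA. Qed.

Lemma pairingDr x y z : pairing x (y + z) = pairing x y + pairing x z.
Proof. by rewrite !(pairingC x) pairingDl. Qed.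

Lemma pairingZr t x y : pairing x (t *: y) = t * pairing x y.
Proof. by rewrite !(pairingC x) pairingZl. Qed.

Lemma pairingNl x y : pairing (- x) y = - pairing x y.
Proof. by rewrite -scaleN1r pairingZl mulN1r. Qed.

Lemma pairingNr x y : pairing x (- y) = - pairing x y.
Proof. by rewrite -scaleN1r pairingZr mulN1r. Qed.

Lemma pairingBl x y z : pairing (x - y) z = pairing x z - pairing y z.
Proof. by rewrite pairingDl pairingNl. Qed.

Lemma pairingBr x y z : pairing x (y - z) = pairing x y - pairing x z.
Proof. by rewrite pairingDr pairingNr. Qed.

Lemma pairing0l y : pairing 0 y = 0.
Proof. by rewrite -(scale0r 0) pairingZl mul0r. Qed.

Lemma pairing0r x : pairing x 0 = 0.
Proof. by rewrite pairingC pairing0l. Qed.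

Lemma pairing_suml (I : Type) (s : seq I) (P : pred I) (F : I -> 'rV[R]_d) y :
  pairing (\sum_(i <- s | P i) F i) y = \sum_(i <- s | P i) pairing (F i) y.
Proof.
by elim/big_rec2: _ => [|i a b _ <-]; rewrite ?pairing0l ?pairingDl.
Qed.

Lemma pairing_sumr (I : Type) (s : seq I) (P : pred I) (F : I -> 'rV[R]_d) x :
  pairing x (\sum_(i <- s | P i) F i) = \sum_(i <- s | P i) pairing x (F i).
Proof. by rewrite pairingC pairing_suml; apply: eq_bigr => i _; exact: pairingC. Qed.

Lemma pairing_self_ge0 x : 0 <= pairing x x.
Proof. by apply: sumr_ge0 => i _; rewrite -expr2 sqr_ge0. Qed.

Lemma pairing_self_eq0 x : pairing x x = 0 -> x = 0.
Proof.
move=> /eqP; rewrite psumr_eq0 => [/allP x0|i _]; last by rewrite -expr2 sqr_ge0.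
apply/rowP => i; rewrite mxE.
by have := x0 i (mem_index_enum _); rewrite /= mulf_eq0 orbb => /eqP.
Qed.

Lemma pairing_self_gt0 x : x <> 0 -> 0 < pairing x x.
Proof.
move=> x0; rewrite lt0r pairing_self_ge0 andbT.
by apply/eqP => /pairing_self_eq0.
Qed.

Definition pairingE := (pairingDl, pairingDr, pairingBl, pairingBr, pairingNl,
  pairingNr, pairingZl, pairingZr, pairing0l, pairing0r).

Lemma lattice0 : lattice (0 : 'rV[R]_d).
Proof. by move=> i; rewrite mxE rpred0. Qed.

Lemma latticeD x y : lattice x -> lattice y -> lattice (x + y).
Proof. by move=> hx hy i; rewrite mxE rpredD. Qed.

Lemma latticeN x : lattice x -> lattice (- x).
Proof. by move=> hx i; rewrite mxE rpredN. Qed.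

Lemma latticeZ t x : t \is a Num.int -> lattice x -> lattice (t *: x).
Proof. by move=> ht hx i; rewrite mxE rpredM. Qed.

Lemma lattice_sum (I : Type) (s : seq I) (P : pred I) (F : I -> 'rV[R]_d) :
  (forall i, lattice (F i)) -> lattice (\sum_(i <- s | P i) F i).
Proof.
move=> hF; elim/big_rec: _ => [|i a _ ha]; [exact: lattice0|exact: latticeD].
Qed.

Lemma pairing_int x y : lattice x -> lattice y -> pairing x y \is a Num.int.
Proof. by move=> hx hy; apply: rpred_sum => i _; apply: rpredM. Qed.

End Pairing.

Section Extend.
Context {R : realType} {d : nat}.
Implicit Types (x y : 'rV[R]_d) (a b t : R) (u : 'rV[R]_(d + 1)).

Definition last_coord u : R := rsubmx u 0 0.

Lemma lsubmx_extend x a : lsubmx (extend x a) = x.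
Proof. exact: row_mxKl. Qed.

Lemma last_extend x a : last_coord (extend x a) = a.
Proof. by rewrite /last_coord row_mxKr mxE. Qed.

Lemma extendK u : extend (lsubmx u) (last_coord u) = u.
Proof.
rewrite -[RHS]hsubmxK; congr row_mx; apply/matrixP => i j.
by rewrite mxE !ord1.
Qed.

Lemma extendD x y a b : extend (x + y) (a + b) = extend x a + extend y b.
Proof.
by rewrite /extend add_row_mx; congr row_mx; apply/matrixP => i j; rewrite !mxE.
Qed.

Lemma extendZ t x a : extend (t *: x) (t * a) = t *: extend x a.
Proof.
by rewrite /extend scale_row_mx; congr row_mx; apply/matrixP => i j; rewrite !mxE.
Qed.

Lemma extend00 : extend (0 : 'rV[R]_d) 0 = 0.
Proof. by rewrite -[RHS](scale0r (extend 0 0)) -extendZ scale0r mul0r. Qed.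

Lemma last_coordD u v : last_coord (u + v) = last_coord u + last_coord v.
Proof. by rewrite /last_coord linearD mxE. Qed.

Lemma last_coordZ t u : last_coord (t *: u) = t * last_coord u.
Proof. by rewrite /last_coord linearZ mxE. Qed.

Lemma last_coord0 : last_coord 0 = 0.
Proof. by rewrite /last_coord linear0 mxE. Qed.

Lemma extend_sum (I : Type) (s : seq I) (P : pred I) (F : I -> 'rV[R]_d)
    (a : I -> R) :
  extend (\sum_(i <- s | P i) F i) (\sum_(i <- s | P i) a i) =
  \sum_(i <- s | P i) extend (F i) (a i).
Proof.
by elim/big_rec3: _ => [|i u b x _ <-]; rewrite ?extend00 ?extendD.
Qed.

Lemma pairing_extend x y a b :
  pairing (extend x a) (extend y b) = pairing x y + a * b.
Proof.
rewrite /pairing big_split_ord /=; congr (_ + _).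
  by apply: eq_bigr => i _; rewrite !row_mxEl.
by rewrite big_ord1 !row_mxEr !mxE.
Qed.

Lemma lattice_extend x a : lattice x -> a \is a Num.int -> lattice (extend x a).
Proof.
move=> hx ha i; rewrite -(splitK i); case: (fintype.split i) => j /=.
  by rewrite row_mxEl.
by rewrite row_mxEr mxE.
Qed.

Lemma lattice_lsubmx u : lattice u -> lattice (lsubmx u).
Proof. by move=> hu i; rewrite mxE. Qed.

Lemma lattice_last u : lattice u -> last_coord u \is a Num.int.
Proof. by move=> hu; rewrite /last_coord mxE. Qed.

End Extend.

(** * Finitely generated cones *)

Section Cone.
Context {R : realType} {d : nat}.
Implicit Types (A B K C : set 'rV[R]_d) (u x y m : 'rV[R]_d) (t : R).

(** The convex cone spanned by [A].  The inductive form lets a comparison of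
    linear forms on the cone be proved by induction from the generators. *)
Inductive cone (A : set 'rV[R]_d) : 'rV[R]_d -> Prop :=
| cone0 : cone A 0
| coneS t u x : 0 <= t -> A u -> cone A x -> cone A (t *: u + x).

Lemma cone_gen A u : A u -> cone A u.
Proof.
by move=> Au; rewrite -[u]scale1r -[_ *: u]addr0; apply: coneS => //; exact: cone0.
Qed.

Lemma coneD A x y : cone A x -> cone A y -> cone A (x + y).
Proof.
move=> + hy; elim=> [|t u z t0 Au _ ih]; first by rewrite add0r.
by rewrite -addrA; exact: coneS.
Qed.

Lemma coneZ A t x : 0 <= t -> cone A x -> cone A (t *: x).
Proof.
move=> t0; elim=> [|s u z s0 Au _ ih]; first by rewrite scaler0; exact: cone0.
by rewrite scalerDr scalerA; apply: coneS => //; exact: mulr_ge0.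
Qed.

Lemma convex_cone_cone A : convex_cone (cone A).
Proof.
split; [exact: cone0| exact: coneD | by move=> t x; exact: coneZ].
Qed.

Lemma cone_min A K : convex_cone K -> A `<=` K -> cone A `<=` K.
Proof.
move=> [K0 KD KZ] AK x; elim=> // t u z t0 Au _ ih.
by apply: KD => //; apply: KZ => //; exact: AK.
Qed.

Lemma cone_mono A B : A `<=` B -> cone A `<=` cone B.
Proof.
by move=> AB; apply: cone_min (convex_cone_cone B) _ => x /AB; exact: cone_gen.
Qed.

Lemma cone_ge0 A m : (forall u, A u -> 0 <= pairing m u) ->
  forall x, cone A x -> 0 <= pairing m x.
Proof.
move=> mA x; elim=> [|t u z t0 Au _ ih]; first by rewrite pairing0r.
by rewrite pairingDr pairingZr addr_ge0// mulr_ge0// mA.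
Qed.

(** Complementary slackness: all the terms of a combination contribute a
    nonnegative amount, so those with a positive coefficient contribute zero.
    Every face below is identified in this way. *)
Lemma cone_slack A m x : (forall u, A u -> 0 <= pairing m u) ->
  cone A x -> pairing m x = 0 ->
  cone (A `&` [set u | pairing m u = 0]) x.
Proof.
move=> mA; elim=> [_|t u z t0 Au hz ih]; first exact: cone0.
rewrite pairingDr pairingZr => /eqP; rewrite paddr_eq0; last 2 first.
- by rewrite mulr_ge0// mA.
- exact: cone_ge0 hz.
rewrite mulf_eq0 => /andP[/orP[/eqP->|/eqP mu] /eqP/ih hz'].
  by rewrite scale0r add0r.
exact: coneS.
Qed.

Lemma cone_eq A m n : (forall u, A u -> pairing m u = pairing n u) ->
  forall x, cone A x -> pairing m x = pairing n x.
Proof.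
by move=> mn x; elim=> [|t u z _ Au _ ih]; rewrite !pairingE// mn// ih.
Qed.

Lemma cone_set0 x : cone set0 x -> x = 0.
Proof. by elim=> // t u z _ []. Qed.

Lemma ray_eq (e u : 'rV[R]_d) t : 0 < t -> u = t *: e -> ray u = ray e.
Proof.
move=> t0 ->; apply/seteqP; split=> x [s s0 ->].
  by exists (s * t); rewrite ?scalerA// mulr_ge0// ltW.
exists (s / t); first by rewrite divr_ge0// ltW.
by rewrite scalerA divfK// gt_eqF.
Qed.

Lemma cone_sum A (I : Type) (s : seq I) (P : pred I) (F : I -> 'rV[R]_d) :
  (forall i, cone A (F i)) -> cone A (\sum_(i <- s | P i) F i).
Proof.
by move=> hF; elim/big_rec: _ => [|i a _ ha]; [exact: cone0|exact: coneD].
Qed.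

Lemma coneP_seq (s : seq 'rV[R]_d) x :
  cone [set` s] x <->
  exists2 a : 'I_(size s) -> R, (forall i, 0 <= a i) & x = \sum_i a i *: s`_i.
Proof.
split=> [|[a a0 ->]].
  elim=> [|t u z t0 /= us _ [a a0 ->]].
    by exists (fun=> 0) => //; rewrite big1// => i _; rewrite scale0r.
  have ui : (index u s < size s)%N by rewrite index_mem.
  pose k := Ordinal ui.
  exists (fun i => (if i == k then t else 0) + a i) => [i|].
    by rewrite addr_ge0//; case: ifP.
  under [RHS]eq_bigr do rewrite scalerDl.
  rewrite big_split/=; congr (_ + _); rewrite (bigD1 k)//= eqxx nth_index//.
  by rewrite big1 ?addr0// => i /negbTE ->; rewrite scale0r.
apply: cone_sum => i; apply: coneZ => //; apply: cone_gen.
exact: mem_nth.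
Qed.

Lemma rational_coneP C : rational_cone C <->
  exists2 s : seq 'rV[R]_d, {in s, forall u, lattice u} & C = cone [set` s].
Proof.
split=> [[k [p [pl ->]]]|[s sl ->]].
  exists [seq p i | i <- enum 'I_k] => [u /mapP[i _ ->]//|].
  apply/seteqP; split=> x.
    case=> a a0 ->; apply: cone_sum => i; apply: coneZ => //; apply: cone_gen.
    by apply/mapP; exists i => //; rewrite mem_enum.
  elim=> [|t u z t0 /mapP[k0 _ ->] _ [a a0 ->]].
    by exists (fun=> 0) => //; rewrite big1// => i _; rewrite scale0r.
  exists (fun i => (if i == k0 then t else 0) + a i) => [i|].
    by rewrite addr_ge0//; case: ifP.
  under [RHS]eq_bigr do rewrite scalerDl.
  rewrite big_split/=; congr (_ + _); rewrite (bigD1 k0)//= eqxx.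
  by rewrite big1 ?addr0// => i /negbTE ->; rewrite scale0r.
exists (size s), (fun i => s`_i); split=> [i|]; first exact/sl/mem_nth.
by apply/seteqP; split=> x /coneP_seq.
Qed.

Lemma rational_cone_convex C : rational_cone C -> convex_cone C.
Proof. by move=> /rational_coneP[s _ ->]; exact: convex_cone_cone. Qed.

Lemma finite_cone_rational A : finite_set A -> A `<=` lattice ->
  rational_cone (cone A).
Proof.
move=> /finite_seqP[s ->] sl; apply/rational_coneP; by exists s.
Qed.

Lemma coneE_cons (p : 'rV[R]_d) s x :
  cone [set` p :: s] x <-> exists2 t, 0 <= t & cone [set` s] (x - t *: p).
Proof.
split=> [|[t t0 hx]].
  elim=> [|t u z t0 /=]; first by exists 0; rewrite // scale0r subrr; exact: cone0.
  rewrite inE => /orP[/eqP-> _ [a a0 ha]|us _ [a a0 ha]].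
    by exists (t + a); [exact: addr_ge0|rewrite scalerDl opprD addrACA subrr add0r].
  by exists a => //; rewrite -addrA; exact: coneS.
rewrite -[x](subrK (t *: p)) addrC; apply: coneS => //=.
  by rewrite inE eqxx.
by apply: cone_mono hx => u /= us; rewrite inE us orbT.
Qed.

End Cone.

Section Weyl.
Context {R : realType} {d : nat}.

Lemma seq_argmax (T : eqType) (s : seq T) (F : T -> R) : s != [::] ->
  exists2 x, x \in s & forall y, y \in s -> F y <= F x.
Proof.
elim: s => // a [|b s] ih _.
  by exists a; [rewrite inE|move=> y; rewrite inE => /eqP->].
have [//|x xs hx] := ih.
have [hax|hxa] := leP (F a) (F x).
  exists x; first by rewrite inE xs orbT.
  by move=> y; rewrite inE => /orP[/eqP->//|/hx].
exists a; first by rewrite inE eqxx.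
move=> y; rewrite inE => /orP[/eqP->//|/hx yx].
exact: le_trans yx (ltW hxa).
Qed.

(** Weyl's theorem, by Fourier-Motzkin elimination of the coefficient of one
    generator at a time.  The forms produced stay in the lattice because the
    elimination multiplies and subtracts but never divides. *)
Lemma weyl (s : seq 'rV[R]_d) : {in s, forall u, lattice u} ->
  exists2 qs : seq 'rV[R]_d, {in qs, forall q, lattice q} &
    forall x, cone [set` s] x <-> {in qs, forall q, 0 <= pairing q x}.
Proof.
elim: s => [_|p s ih sl].
  pose e (i : 'I_d) : 'rV[R]_d := delta_mx 0 i.
  have el i : lattice (e i) by move=> j; rewrite mxE; case: (_ && _).
  have eE i x : pairing (e i) x = x 0 i.
    rewrite /pairing (bigD1 i)//= mxE !eqxx mul1r big1 ?addr0// => j ji.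
    by rewrite mxE eqxx (negbTE ji) mul0r.
  exists ([seq e i | i <- enum 'I_d] ++ [seq - e i | i <- enum 'I_d]).
    move=> q; rewrite mem_cat => /orP[] /mapP[i _ ->] //.
    exact: latticeN.
  move=> x; split=> [hx|hx].
    suff -> : x = 0 by move=> q _; rewrite pairing0r.
    by apply: cone_set0; apply: cone_mono hx => u.
  suff -> : x = 0 by exact: cone0.
  apply/rowP => i; rewrite mxE; apply/eqP; rewrite eq_le.
  have := hx (e i); rewrite eE mem_cat map_f ?mem_enum// => ->//.
  have := hx (- e i); rewrite pairingNl eE mem_cat [X in _ || X]map_f ?mem_enum//.
  by rewrite orbT oppr_ge0 andbT; exact.
have [|qs ql hqs] := ih; first by move=> u us; apply: sl; rewrite inE us orbT.
have pl : lattice p by apply: sl; rewrite inE eqxx.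
pose Q := [seq q <- qs | 0 <= pairing q p].
pose N := [seq q <- qs | pairing q p < 0].
exists (Q ++ [seq pairing q1 p *: q2 - pairing q2 p *: q1 | q1 <- Q, q2 <- N]).
  move=> q; rewrite mem_cat => /orP[|/allpairsP[[q1 q2] /= []]].
    by rewrite mem_filter => /andP[_ /ql].
  rewrite !mem_filter => /andP[_ /ql l1] /andP[_ /ql l2] ->.
  by apply: latticeD; [|apply: latticeN]; apply: latticeZ => //; exact: pairing_int.
move=> x; rewrite coneE_cons; split=> [[t t0 /hqs hx] q|hx].
  have hxq q0 : q0 \in qs -> t * pairing q0 p <= pairing q0 x.
    by move=> /hx; rewrite pairingBr pairingZr subr_ge0.
  rewrite mem_cat => /orP[|/allpairsP[[q1 q2] /= []]].
    rewrite mem_filter => /andP[qp /hxq]; apply: le_trans; exact: mulr_ge0.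
  rewrite !mem_filter => /andP[p1 /hxq h1] /andP[p2 /hxq h2] ->.
  rewrite !pairingE; nra.
(* The least admissible coefficient of [p]; the combined forms say exactly that it
   does not exceed any of the upper bounds. *)
have [|t tL tmax] := @seq_argmax R (0 :: [seq pairing q x / pairing q p | q <- N]) id.
  by [].
exists t; first by apply: tmax; rewrite inE eqxx.
apply/hqs => q qqs; rewrite pairingBr pairingZr subr_ge0.
have [qp|qp] := ltP (pairing q p) 0.
  rewrite -ler_ndivrMr//; apply: tmax; rewrite inE; apply/orP; right.
  by apply/mapP; exists q => //; rewrite mem_filter qp.
have qQ : q \in Q by rewrite mem_filter qp.
move: tL; rewrite inE => /orP[/eqP->|/mapP[q2 q2N ->]].
  by rewrite mul0r; apply: hx; rewrite mem_cat qQ.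
have q2p : pairing q2 p < 0 by move: q2N; rewrite mem_filter => /andP[].
have : 0 <= pairing (pairing q p *: q2 - pairing q2 p *: q) x.
  apply: hx; rewrite mem_cat; apply/orP; right.
  by apply/allpairsP; exists (q, q2).
rewrite !pairingE subr_ge0 => hh.
by rewrite mulrAC ler_ndivrMr// [leLHS]mulrC [leRHS]mulrC.
Qed.

End Weyl.

Section Near.
Context {R : realType}.

Lemma near_all_seq (T : eqType) (s : seq T) (P : T -> R -> Prop) :
  (forall x, x \in s -> \forall t \near 0^'+, P x t) ->
  \forall t \near 0^'+, forall x, x \in s -> P x t.
Proof.
elim: s => [_|a s ih hs]; first by near=> t.
have ha : \forall t \near 0^'+, P a t by apply: hs; rewrite inE eqxx.
have hr : \forall t \near 0^'+, forall x, x \in s -> P x t.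
  by apply: ih => x xs; apply: hs; rewrite inE xs orbT.
near=> t => x; rewrite inE => /orP[/eqP->|xs].
  by near: t.
by move: x xs; near: t.
Unshelve. all: by end_near.
Qed.

Lemma near0_gt0 (a b : R) : 0 < a -> \forall t \near 0^'+, 0 < a + t * b.
Proof.
move=> a0; have [b0|b0] := leP 0 b.
  by near=> t; apply: ltr_wpDr => //; apply: mulr_ge0.
have ab : 0 < a / - b by rewrite divr_gt0// oppr_gt0.
near=> t; have : t < a / - b by near: t; exact: nbhs_right_lt.
by rewrite ltr_pdivlMr ?oppr_gt0// mulrN -subr_gt0 opprK.
Unshelve. all: by end_near.
Qed.

Lemma near0_ex (P : R -> Prop) : (\forall t \near 0^'+, P t) ->
  exists2 t, 0 < t & P t.
Proof.
move=> h; have : \forall t \near 0^'+, (0 : R) < t /\ P t.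
  by near=> t; split=> //; near: t.
by move=> /filter_ex[t []]; exists t.
Unshelve. all: by end_near.
Qed.

End Near.

Section ConeMore.
Context {R : realType} {d : nat}.
Implicit Types (A B C : set 'rV[R]_d) (x y m u : 'rV[R]_d).

Lemma cone_linear e (f : 'rV[R]_d -> 'rV[R]_e) A (B : set 'rV[R]_e) :
  (forall t u x, f (t *: u + x) = t *: f u + f x) -> f 0 = 0 ->
  (forall u, A u -> cone B (f u)) -> forall x, cone A x -> cone B (f x).
Proof.
move=> fl f0 fAB x; elim=> [|t u z t0 Au _ ih]; first by rewrite f0; exact: cone0.
by rewrite fl; apply: coneD => //; apply: coneZ => //; exact: fAB.
Qed.

(** The witness is the sum of the generators.  Points of the relative interior
    reduce the comparison of two cones of a fan to one vector. *)
Lemma cone_relint A : finite_set A -> exists2 y, cone A y &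
  forall m, (forall u, A u -> 0 <= pairing m u) -> pairing m y = 0 ->
    forall u, A u -> pairing m u = 0.
Proof.
move=> /finite_seqP[s ->]; exists (\sum_(u <- s) u).
  rewrite big_seq; elim/big_rec: _ => [|u x us ih]; first exact: cone0.
  by apply: coneD => //; exact: cone_gen.
move=> m m0; rewrite pairing_sumr => /eqP.
rewrite big_seq psumr_eq0 => [/allP h u /= us|u us]; last exact: m0.
by have := h u us; rewrite us => /eqP.
Qed.

Lemma rational_relint C : rational_cone C -> exists2 y, C y &
  forall m, (forall u, C u -> 0 <= pairing m u) -> pairing m y = 0 ->
    forall u, C u -> pairing m u = 0.
Proof.
move=> /rational_coneP[s _ ->].
have [y hy ry] := cone_relint (finite_seq s).
exists y => // m m0 my u hu.
rewrite -(pairing0l u); apply: cone_eq hu => v hv; rewrite pairing0l.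
by apply: (ry m) => // w hw; apply: m0; exact: cone_gen.
Qed.

(** The generators of a generating set of minimal size span faces.  The face of
    [C] through such a generator [p] consists of the [x] for which [p - t x] is
    still in [C] for some [t > 0]; writing both [x] and [p - t x] in the
    generators, minimality forbids any generator but [p]. *)
Lemma strongly_convex_extreme C : rational_cone C -> strongly_convex C ->
  exists s : seq 'rV[R]_d, [/\ {in s, forall u, lattice u}, C = cone [set` s] &
    {in s, forall u, u <> 0 /\ cone_face (ray u) C}].
Proof.
move=> /rational_coneP[s0 s0l C0] Cs.
pose Q n := `[< exists s : seq 'rV[R]_d,
  [/\ size s = n, {in s, forall u, lattice u} & C = cone [set` s]] >].
have exQ : exists n, Q n by exists (size s0); apply/asboolP; exists s0.
case: (ex_minnP exQ) => n /asboolP[s [sn sl Cs']] nmin.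
exists s; split=> // p ps; set s' := rem p s.
have sE : [set` s] = [set` p :: s'].
  by apply/seteqP; split=> x /=; rewrite (perm_mem (perm_to_rem ps)).
have s'C x : cone [set` s'] x -> C x.
  by rewrite Cs' sE; apply: cone_mono => u /= us; rewrite inE us orbT.
have pC : C p by rewrite Cs'; exact: cone_gen.
have pN : ~ cone [set` s'] p.
  move=> hp; have : Q (size s').
    apply/asboolP; exists s'; split=> //.
      by move=> u /mem_rem; exact: sl.
    apply/seteqP; split=> [x|]; last exact: s'C.
    rewrite Cs' sE => /cone_min; apply; first exact: convex_cone_cone.
    by move=> u /=; rewrite inE => /orP[/eqP->//|us]; exact: cone_gen.
  move=> /nmin; rewrite size_rem// -sn -ltnS prednK ?ltnn//.
  by case: (s) ps.
split; first by move=> p0; apply: pN; rewrite p0; exact: cone0.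
have [qs _ qsP] := weyl sl.
have {}qsP x : C x <-> {in qs, forall q, 0 <= pairing q x} by rewrite Cs'.
(* The sum of the facet forms through [p] cuts out the smallest face at [p]. *)
pose M := \sum_(q <- qs | pairing q p == 0) q.
have M0 x : C x -> 0 <= pairing M x.
  move=> /qsP hx; rewrite pairing_suml big_seq_cond sumr_ge0// => q /andP[qq _].
  exact: hx.
have CC : convex_cone C by rewrite Cs'; exact: convex_cone_cone.
have [_ CD CZ] := CC.
have Mp : pairing M p = 0.
  by rewrite pairing_suml big1// => q /eqP.
exists M; split=> //; apply/seteqP; split=> [x [t t0 ->]|x [Cx Mx]].
  by split=> /=; [exact: CZ|rewrite pairingZr Mp mulr0].
have qpx q : q \in qs -> pairing q p = 0 -> pairing q x = 0.
  move: Mx => /= /eqP; rewrite pairing_suml big_seq_cond psumr_eq0.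
    by move=> /allP h qq /eqP qp; have := h q qq; rewrite qq qp => /eqP.
  by move=> i /andP[iq _]; move/qsP : Cx => /(_ _ iq).
have : \forall t \near 0^'+, forall q, q \in qs -> 0 <= pairing q (p - t *: x).
  apply: near_all_seq => q qq.
  have : 0 <= pairing q p by move/qsP : pC; exact.
  rewrite le_eqVlt => /orP[/eqP qp|qp].
    by near=> t; rewrite pairingBr pairingZr -qp qpx// mulr0 subrr.
  have := near0_gt0 (- pairing q x) qp; apply: filterS => t /ltW.
  by rewrite pairingBr pairingZr mulrN.
move=> /near0_ex[t t0 /qsP]; move: (Cx); rewrite Cs' sE.
move=> /coneE_cons[a a0 ha] /coneE_cons[b b0 hb].
have hab : cone [set` s'] (t *: (x - a *: p) + (p - t *: x - b *: p)).
  by apply: coneD => //; apply: coneZ => //; exact: ltW.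
have [ab|ab] := ltP 0 (1 - t * a - b).
  exfalso; apply: pN.
  have -> : p = (1 - t * a - b)^-1 *: (t *: (x - a *: p) + (p - t *: x - b *: p)).
    rewrite [X in _ *: X](_ : _ = (1 - t * a - b) *: p).
      by rewrite scalerA mulVf ?gt_eqF// scale1r.
    by apply/rowP => i; rewrite !mxE; ring.
  by apply: coneZ => //; rewrite invr_ge0 ltW.
have : t *: (x - a *: p) = 0.
  apply: Cs; first by apply: CZ; [exact: ltW|exact: s'C].
  rewrite [X in C X](_ : _ = (p - t *: x - b *: p) + (t * a + b - 1) *: p).
    apply: CD; [exact: s'C|apply: CZ => //].
    by move: ab; set w := t * a; lra.
  by apply/rowP => i; rewrite !mxE; ring.
move=> /eqP; rewrite scaler_eq0 gt_eqF//= subr_eq0 => /eqP ->.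
by exists a.
Unshelve. all: by end_near.
Qed.

End ConeMore.

(** * Linear programs and normal fans of polyhedra *)

Section SupportFunction.
Context {R : realType} {d : nat}.
Implicit Types (P A D C : set 'rV[R]_d) (x y m u : 'rV[R]_d).

Lemma support_fun_face P x y : polyhedron_face P y x ->
  support_fun P y = - pairing x y.
Proof.
move=> [Px xmin]; congr (- _); apply/eqP; rewrite eq_le; apply/andP; split.
  apply: ge_inf; last by exists x.
  by exists (pairing x y) => _ [z Pz <-]; exact: xmin.
apply: lb_le_inf; first by exists (pairing x y), x.
by move=> _ [z Pz <-]; exact: xmin.
Qed.

End SupportFunction.

Section Polyhedron.
Context {R : realType} {d : nat}.
Implicit Types (G A D C : set 'rV[R]_d) (c : 'rV[R]_d -> R).
Implicit Types (x y m u : 'rV[R]_d).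

Definition polyh G c : set 'rV[R]_d :=
  [set x | forall u, G u -> - c u <= pairing x u].

Definition active G c x : set 'rV[R]_d := [set u | G u /\ pairing x u = - c u].

Definition act_cone G c x : set 'rV[R]_d := cone (active G c x).

(** The normal fan of a polyhedron given by inequalities, described through the
    inequalities that are active at its points: in this form the fan axioms
    can be read off from short moves inside the polyhedron. *)
Definition act_fan G c : set (set 'rV[R]_d) :=
  [set act_cone G c x | x in polyh G c].

Lemma active_ge0 G c x x' u : polyh G c x' -> active G c x u ->
  0 <= pairing (x' - x) u.
Proof. by move=> hx' [Gu xu]; rewrite pairingBl xu opprK -lerBlDr sub0r hx'. Qed.

Lemma act_cone_sub G c x : act_cone G c x `<=` cone G.
Proof. by apply: cone_mono => u []. Qed.

Lemma act_cone_face G c x y : polyh G c x -> act_cone G c x y ->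
  polyhedron_face (polyh G c) y x.
Proof.
move=> hx hy; split=> // x' hx'; rewrite -subr_ge0 -pairingBl.
by apply: cone_ge0 hy => u; exact: active_ge0.
Qed.

Lemma support_act_cone G c x y : polyh G c x -> act_cone G c x y ->
  support_fun (polyh G c) y = - pairing x y.
Proof. by move=> hx /(act_cone_face hx)/support_fun_face. Qed.

(** Complementarity for another minimiser [x'] of [y]: the coefficients of [y]
    vanish at the inequalities that are slack at [x']. *)
Lemma act_cone_common G c x x' y : polyh G c x' -> act_cone G c x y ->
  pairing x' y = pairing x y -> cone (active G c x `&` active G c x') y.
Proof.
move=> hx' hy xy; apply: cone_mono; last first.
  apply: (cone_slack (m := x' - x)) hy _; first by move=> u; exact: active_ge0.
  by rewrite pairingBl xy subrr.
move=> u [[Gu xu] /= /eqP]; rewrite pairingBl subr_eq0 xu => /eqP xu'.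
by split; split.
Qed.

Lemma finite_subsets (T : choiceType) (G : set T) : finite_set G ->
  finite_set [set A | A `<=` G].
Proof.
move=> /finite_seqP[s ->].
pose F (f : {ffun 'I_(size s) -> bool}) : set T :=
  [set x | exists2 i, f i & x = tnth (in_tuple s) i].
apply: (@sub_finite_set _ _ (F @` setT)); last first.
  by apply: finite_image; exact: finite_finset.
move=> A As; exists [ffun i => `[< A (tnth (in_tuple s) i) >]] => //.
apply/seteqP; split=> x; first by case=> i; rewrite ffunE => /asboolP + ->.
move=> Ax; have /seq_tnthP[i xi] : x \in s by exact: As.
by exists i => //; rewrite ffunE -xi; exact/asboolP.
Qed.

(** A short move from [x] along a form [m] that is nonnegative on the active
    inequalities keeps the others strict: this realises the face of
    [act_cone G c x] cut out by [m] as another cone of the fan. *)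
Lemma near_polyh G c x m : finite_set G -> polyh G c x ->
  (forall u, active G c x u -> 0 <= pairing m u) ->
  \forall t \near 0^'+, polyh G c (x + t *: m) /\
    active G c (x + t *: m) = active G c x `&` [set u | pairing m u = 0].
Proof.
move=> /finite_seqP[s Gs] hx mx.
have : \forall t \near 0^'+, forall u, u \in s ->
    - c u <= pairing (x + t *: m) u /\
    (pairing (x + t *: m) u = - c u <->
     pairing x u = - c u /\ pairing m u = 0).
  apply: near_all_seq => u us.
  have Gu : G u by rewrite Gs.
  have := hx u Gu; rewrite le_eqVlt => /orP[/eqP xu|xu].
    have mu : 0 <= pairing m u by apply: mx.
    near=> t; have t0 : 0 < t by [].
    rewrite pairingDl pairingZl -xu lerDl; split; first by rewrite mulr_ge0// ltW.
    split=> [/eqP|[_ ->]]; last by rewrite mulr0 addr0.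
    by rewrite -subr_eq0 addrC addKr mulf_eq0 gt_eqF//= => /eqP.
  have : 0 < pairing x u + c u by rewrite -ltrBlDr sub0r.
  move=> /(near0_gt0 (pairing m u)); apply: filterS => t.
  rewrite addrAC -ltrBlDr sub0r -pairingZl -pairingDl => h.
  split; first exact: ltW.
  by split=> [h'|[h' _]]; [rewrite h' ltxx in h|rewrite h' ltxx in xu].
apply: filterS => t ht; split=> [u|]; first by rewrite Gs => /ht[].
apply/seteqP; split=> u.
  move=> [Gu h]; have us : u \in s by rewrite Gs in Gu.
  by have [_ /iffLR/(_ h)[xu mu]] := ht u us.
move=> [[Gu xu] mu]; have us : u \in s by rewrite Gs in Gu.
by split=> //; have [_ /iffRL] := ht u us; apply.
Unshelve. all: by end_near.
Qed.

(** A strictly feasible point [q] makes [q - x] positive on the active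
    inequalities, whence strong convexity.  The form [x' - x] cuts out of the cone
    of [x] its intersection with the cone of [x']. *)
Lemma act_fan_is_fan G c q : finite_set G -> G `<=` lattice ->
  (forall u, G u -> - c u < pairing q u) -> is_fan (act_fan G c).
Proof.
move=> Gf Gl hq.
have qP : polyh G c q by move=> u /hq/ltW.
split.
- apply: (@sub_finite_set _ _ (cone @` [set A | A `<=` G])).
    by move=> _ [x _ <-]; exists (active G c x) => // u [].
  by apply: finite_image; exact: finite_subsets.
- by exists (act_cone G c q), q.
- move=> _ [x hx <-]; split.
    apply: finite_cone_rational; last by move=> u [/Gl].
    by apply: sub_finite_set Gf => u [].
  move=> y hy hy'; apply: cone_set0.
  have qx u : active G c x u -> 0 < pairing (q - x) u.
    by move=> [Gu xu]; rewrite pairingBl xu subr_gt0; exact: hq.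
  have qx0 u : active G c x u -> 0 <= pairing (q - x) u by move=> /qx/ltW.
  have qy : pairing (q - x) y = 0.
    apply/eqP; rewrite eq_le (cone_ge0 qx0 hy) andbT -oppr_ge0 -pairingNr.
    exact: cone_ge0 hy'.
  apply: cone_mono (cone_slack qx0 hy qy) => u [/qx + /= h0].
  by rewrite h0 ltxx.
- move=> _ F [x hx <-] [m [m0 ->]].
  have mx u : active G c x u -> 0 <= pairing m u.
    by move=> hu; apply: m0; exact: cone_gen.
  have [t t0 [ht ta]] := near0_ex (near_polyh Gf hx mx).
  exists (x + t *: m) => //; rewrite /act_cone ta; apply/seteqP; split=> y.
    elim=> [|a u z a0 [hu mu] _ [h1 h2]].
      by split; [exact: cone0|rewrite /= pairing0r].
    split; first exact: coneS.
    by rewrite /= !pairingE h2 mu mulr0 addr0.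
  by move=> [hy my]; exact: cone_slack.
- have faceI x x' : polyh G c x -> polyh G c x' ->
      cone_face (act_cone G c x `&` act_cone G c x') (act_cone G c x).
    move=> hx hx'; exists (x' - x); split.
      by move=> y; apply: cone_ge0 => u; exact: active_ge0.
    apply/seteqP; split=> y [hy].
      move=> hy'; split=> //=; rewrite pairingBl.
      have := support_act_cone hx hy; rewrite (support_act_cone hx' hy').
      by move=> /oppr_inj ->; rewrite subrr.
    move=> /= h0; split=> //.
    have xy : pairing x' y = pairing x y.
      by apply/eqP; rewrite -subr_eq0 -pairingBl h0.
    by apply: cone_mono (act_cone_common hx' hy xy) => u [].
  move=> _ _ [x hx <-] [x' hx' <-]; split; first exact: faceI.
  by rewrite setIC; exact: faceI.
Qed.

(** Strong duality of linear programming.  The cone over the points [(u, c u)],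
    closed upwards, is cut out by finitely many forms; the one that bounds the
    fibre over [y] from below is, once normalised, an optimal point [x].  It is
    rational because the forms are integral. *)
Lemma lp_duality G c y : finite_set G -> G `<=` lattice ->
  (forall u, G u -> c u \is a Num.int) -> polyh G c !=set0 -> cone G y ->
  exists x, [/\ polyh G c x, act_cone G c x y &
    exists2 k : nat, (0 < k)%N & lattice (k%:R *: x)].
Proof.
move=> /finite_seqP[s Gs] Gl cint [x0 hx0] hy.
pose s' := extend 0 1 :: [seq extend u (c u) | u <- s].
have s'E u : G u -> extend u (c u) \in s'.
  by rewrite Gs => us; rewrite inE (map_f (fun u => extend u (c u))) ?orbT.
have s'P v : v \in s' -> v = extend 0 1 \/ exists2 u, G u & v = extend u (c u).
  rewrite inE => /orP[/eqP|/mapP[u us ->]]; [by left|right].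
  by exists u => //; rewrite Gs.
have [v /s'P[->|[u Gu ->]]|qs qsl qsP] := @weyl _ _ s'.
- by apply: lattice_extend; [exact: lattice0|exact: rpred1].
- by apply: lattice_extend; [exact: Gl|exact: cint].
have extE (q : 'rV[R]_(d + 1)) x a :
    pairing q (extend x a) = pairing (lsubmx q) x + last_coord q * a.
  by rewrite -{1}(extendK q) pairing_extend.
have q0 q : q \in qs -> 0 <= last_coord q.
  move=> qq; have /qsP/(_ q qq) : cone [set` s'] (extend 0 1).
    by apply: cone_gen; rewrite /= inE eqxx.
  by rewrite extE pairing0r add0r mulr1.
have [a0 ha0] : exists a, cone [set` s'] (extend y a).
  elim: hy => [|t u z t0 Gu _ [a ha]].
    by exists 0; rewrite extend00; exact: cone0.
  exists (t * c u + a); rewrite extendD extendZ; apply: coneS => //.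
  exact: s'E.
have bnd a : cone [set` s'] (extend y a) -> - pairing x0 y <= a.
  move=> ha; suff : 0 <= pairing (extend x0 1) (extend y a).
    by rewrite pairing_extend mul1r -lerBlDl sub0r.
  apply: cone_ge0 ha => v /s'P[->|[u /hx0 Gu ->]]; rewrite pairing_extend.
    by rewrite pairing0r mul1r add0r.
  by rewrite mul1r -lerBlDr sub0r.
pose T := [seq q <- qs | 0 < last_coord q].
have TN : T != [::].
  apply/eqP => T0; have : cone [set` s'] (extend y (- pairing x0 y - 1)).
    apply/qsP => q qq; have := q0 q qq; rewrite le_eqVlt => /orP[/eqP ql|ql].
      by move/qsP : ha0 => /(_ q qq); rewrite !extE -ql !mul0r.
    have : q \in T by rewrite mem_filter ql.
    by rewrite T0.
  by move=> /bnd; rewrite -subr_ge0 addrAC subrr add0r oppr_ge0 ler10.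
have [q] := seq_argmax (fun q => - pairing (lsubmx q) y / last_coord q) TN.
rewrite mem_filter => /andP[ql qq] qmax.
set a := - pairing (lsubmx q) y / last_coord q in qmax.
have ha : cone [set` s'] (extend y a).
  apply/qsP => q' q'q; have := q0 q' q'q; rewrite le_eqVlt => /orP[/eqP ql'|ql'].
    by move/qsP : ha0 => /(_ q' q'q); rewrite !extE -ql' !mul0r.
  have : q' \in T by rewrite mem_filter ql'.
  by move=> /qmax; rewrite ler_pdivrMr// extE mulrC -lerBlDl sub0r.
have qa : pairing q (extend y a) = 0.
  by rewrite extE /a mulrC divfK ?gt_eqF// subrr.
have qs' u : G u -> 0 <= pairing (lsubmx q) u + last_coord q * c u.
  move=> Gu; rewrite -extE; move: q qq {ql qmax a ha qa} => q qq.
  have /qsP : cone [set` s'] (extend u (c u)) by apply: cone_gen; exact: s'E.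
  exact.
exists ((last_coord q)^-1 *: lsubmx q); split.
- move=> u /qs' qu; rewrite pairingZl ler_pdivlMl// mulrN -subr_ge0 opprK.
  exact: qu.
- have q0' v : [set` s'] v -> 0 <= pairing q v.
    move=> /s'P[->|[u Gu ->]]; rewrite extE; last exact: qs'.
    by rewrite pairing0r add0r mulr1 ltW.
  have := cone_slack q0' ha qa.
  rewrite -{2}(lsubmx_extend y a).
  apply: (@cone_linear _ _ _ (@lsubmx _ 1 d 1)).
  + by move=> t u x; rewrite linearP.
  + exact: linear0.
  + move=> v [/s'P[->|[u Gu ->]]] /=; rewrite extE.
      by rewrite pairing0r add0r mulr1 => ql0; rewrite ql0 ltxx in ql.
    move=> qu; rewrite lsubmx_extend; apply: cone_gen; split=> //.
    rewrite pairingZl; apply: (mulfI (lt0r_neq0 ql)).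
    by rewrite mulVKf ?lt0r_neq0// mulrN; apply/eqP; rewrite -addr_eq0 qu.
- have /natrP[k kE] : last_coord q \is a Num.nat.
    rewrite natrEint; apply/andP; split; last exact: ltW.
    by apply: lattice_last; exact: qsl.
  exists k; first by rewrite -(ltr_nat R) -kE.
  by rewrite -kE scalerA divff ?gt_eqF// scale1r; apply: lattice_lsubmx; exact: qsl.
Qed.

End Polyhedron.

Section NormalFanPolyhedron.
Context {R : realType} {d : nat}.
Variables (G : set 'rV[R]_d) (c : 'rV[R]_d -> R).
Hypotheses (Gf : finite_set G) (Gl : G `<=` lattice).
Hypothesis cint : forall u, G u -> c u \is a Num.int.
Implicit Types (x y z m u : 'rV[R]_d).

(** A form that attains its minimum lies in the cone of all the inequalities:
    otherwise a form separating it from that cone would be a direction in which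
    the polyhedron is unbounded and the values decrease. *)
Lemma face_act_cone x z : polyhedron_face (polyh G c) z x -> act_cone G c x z.
Proof.
move=> [hx xmin].
have zG : cone G z.
  have /finite_seqP[s Gs] := Gf.
  have [|qs _ qsP] := @weyl _ _ s; first by move=> u us; apply: Gl; rewrite Gs.
  rewrite Gs; apply/qsP => q qq.
  have qG u : G u -> 0 <= pairing q u.
    by rewrite Gs => /cone_gen/qsP; apply.
  have : polyh G c (x + q).
    by move=> u Gu; rewrite pairingDl -[leLHS]addr0 lerD ?hx ?qG.
  by move=> /xmin; rewrite pairingDl lerDl.
have [x' [hx' zx' _]] := lp_duality Gf Gl cint (ex_intro _ x hx) zG.
apply: cone_mono (act_cone_common hx zx' _) => [u []//|].
by apply/eqP; rewrite eq_le (xmin _ hx') (act_cone_face hx' zx').2.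
Qed.

Lemma fan_support_act_fan : polyh G c !=set0 ->
  fan_support (act_fan G c) = cone G.
Proof.
move=> P0; apply/seteqP; split=> [y [_ [x _ <-]]|y hy]; first exact: act_cone_sub.
have [x [hx hxy _]] := lp_duality Gf Gl cint P0 hy.
by exists (act_cone G c x) => //; exists x.
Qed.

(** Average points of the face that leave slack the inequalities that are not
    active along the whole face. *)
Lemma face_relint y : polyhedron_face (polyh G c) y !=set0 ->
  exists2 x, polyhedron_face (polyh G c) y x &
    forall x', polyhedron_face (polyh G c) y x' -> active G c x `<=` active G c x'.
Proof.
move=> [x0 hx0]; have /finite_seqP[s Gs] := Gf.
suff [x hx xs] : exists2 x, polyhedron_face (polyh G c) y x &
    forall u, u \in s -> active G c x u ->
    forall x', polyhedron_face (polyh G c) y x' -> active G c x' u.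
  exists x => // x' hx' u au.
  have us : u \in s by have := au.1; rewrite Gs.
  exact: xs us au _ hx'.
have : {subset s <= s} by [].
elim: {-2}s => [|v r ih] rs; first by exists x0.
have [u ur|x hx xr] := ih; first by apply: rs; rewrite inE ur orbT.
have [hv|] := pselect (forall x', polyhedron_face (polyh G c) y x' ->
                           active G c x' v).
  by exists x => // u; rewrite inE => /orP[/eqP->//|]; exact: xr.
move=> /existsNP[x1 /not_implyP[hx1 ax1]].
have Gv : G v by rewrite Gs; apply: rs; rewrite inE eqxx.
pose w := 2^-1 *: (x + x1).
have wE u : pairing w u = 2^-1 * (pairing x u + pairing x1 u).
  by rewrite pairingZl pairingDl.
have wa u : active G c w u -> active G c x u /\ active G c x1 u.
  move=> [Gu]; rewrite wE => h.
  by have := hx.1 u Gu; have := hx1.1 u Gu => h1 h2; split; split=> //; lra.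
exists w; last first.
  move=> u; rewrite inE => /orP[/eqP->/wa[_ //]|ur /wa[au _]].
  exact: xr ur au.
split.
  move=> u Gu; rewrite wE; have := hx.1 u Gu; have := hx1.1 u Gu; lra.
by move=> z hz; rewrite wE; have := hx.2 z hz; have := hx1.2 z hz; lra.
Qed.

Lemma normal_fan_polyh : polyh G c !=set0 ->
  normal_fan (polyh G c) = act_fan G c.
Proof.
move=> P0; apply/seteqP; split=> [_ [y [/face_relint[x hx xmin] ->]]|].
  exists x; first exact: hx.1.
  apply/seteqP; split=> z hz; last by apply: face_act_cone; exact: hz.
  move=> x' hx'; apply: act_cone_face; first exact: hx'.1.
  by apply: cone_mono hz; exact: xmin.
move=> _ [x hx <-].
have [|y hy ry] := @cone_relint _ _ (active G c x).
  by apply: sub_finite_set Gf => u [].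
have hxy := act_cone_face hx hy.
exists y; split; first by exists x.
apply/seteqP; split=> z hz; last by apply: face_act_cone; exact: hz.
move=> x' [hx' x'min]; have [_ xmin] := act_cone_face hx hz.
split=> // w hw; have -> : pairing x' z = pairing x z; last exact: xmin.
apply: cone_eq hz => u hu; apply/eqP; rewrite -subr_eq0 -pairingBl; apply/eqP.
apply: ry hu => [v|]; first exact: active_ge0.
rewrite pairingBl; apply/eqP; rewrite subr_eq0 eq_le x'min//.
exact: hxy.2.
Qed.

End NormalFanPolyhedron.

(** * Strict convexity through supporting forms *)

Section Exposed.
Context {R : realType} {d : nat}.
Implicit Types (A C D : set 'rV[R]_d) (g : 'rV[R]_d -> R).
Implicit Types (S : set (set 'rV[R]_d)) (x y p : 'rV[R]_d).

(** Some supporting form of the graph of [g] touches it exactly over [C].  For all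
    the cones of a fan together this is strict convexity, in a form that visibly
    survives the addition of a convex function linear on the cones. *)
Definition exposed A g C : Prop :=
  exists2 p, (forall x, A x -> pairing p x <= g x) &
    C = A `&` [set x | g x = pairing p x].

Lemma act_cone_exposed G c x : finite_set G -> G `<=` lattice ->
  (forall u, G u -> c u \is a Num.int) -> polyh G c x ->
  exposed (cone G) (support_fun (polyh G c)) (act_cone G c x).
Proof.
move=> Gf Gl cint hx; exists (- x) => [y hy|].
  have [x' [hx' hy' _]] := lp_duality Gf Gl cint (ex_intro _ x hx) hy.
  rewrite (support_act_cone hx' hy') pairingNl lerN2.
  exact: (act_cone_face hx' hy').2.
apply/seteqP; split=> y.
  move=> hy; split; first exact: act_cone_sub hy.
  by rewrite /= (support_act_cone hx hy) pairingNl.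
move=> [hy /=].
have [x' [hx' hy' _]] := lp_duality Gf Gl cint (ex_intro _ x hx) hy.
rewrite (support_act_cone hx' hy') pairingNl => /oppr_inj xy.
by apply: cone_mono (act_cone_common hx hy' (esym xy)) => u [].
Qed.

(** If [D] met the complement of every cone, the sum of one point outside each
    would lie strictly above all the linear lower bounds. *)
Lemma linearity_domain_sub S g D : finite_set S ->
  (forall C, S C -> exposed (fan_support S) g C) ->
  linearity_domain (fan_support S) g D -> exists2 C, S C & D `<=` C.
Proof.
move=> /finite_seqP[s Ss] Sexp [[D0 DD DZ] DA [m gm]].
apply: contrapT => noC.
have [p hp] : exists p : set 'rV[R]_d -> 'rV[R]_d, forall C, S C ->
    (forall x, fan_support S x -> pairing (p C) x <= g x) /\
    C = fan_support S `&` [set x | g x = pairing (p C) x].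
  have [p hp] : {p : set 'rV[R]_d -> 'rV[R]_d & forall C, S C ->
      (forall x, fan_support S x -> pairing (p C) x <= g x) /\
      C = fan_support S `&` [set x | g x = pairing (p C) x]}.
    apply: (@choice _ _ (fun C (p : 'rV[R]_d) => S C ->
      (forall x, fan_support S x -> pairing p x <= g x) /\
      C = fan_support S `&` [set x | g x = pairing p x])) => C.
    have [SC|nSC] := pselect (S C); last by exists 0.
    by have [p h1 h2] := Sexp _ SC; exists p.
  by exists p.
suff [y Dy hy] : exists2 y, D y & forall C, C \in s -> pairing (p C) y < g y.
  have [C SC Cy] := DA _ Dy; have := SC; rewrite Ss => /hy.
  by move: Cy; rewrite {1}(hp _ SC).2 => -[_ /= ->]; rewrite ltxx.
have : {subset s <= s} by [].
elim: {-2}s => [|C r ih] rs; first by exists 0.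
have [C' C'r|y Dy hy] := ih; first by apply: rs; rewrite inE C'r orbT.
have SC : S C by rewrite Ss; apply: rs; rewrite inE eqxx.
have [x [Dx Cx]] : exists x, D x /\ ~ C x.
  apply: contrapT => /forallNP h; apply: noC; exists C => // x Dx.
  by apply: contrapT => Cx; apply: (h x).
have xlt C' : C' \in r \/ C' = C -> pairing (p C') (y + x) < g (y + x).
  have gE : g (y + x) = g y + g x by rewrite !gm ?pairingDr//; exact: DD.
  rewrite gE pairingDr => -[C'r|->].
    apply: ltr_leD; first exact: hy.
    by apply: (hp _ _).1; [rewrite Ss; apply: rs; rewrite inE C'r orbT|exact: DA].
  apply: ler_ltD; first by apply: (hp _ SC).1; exact: DA.
  rewrite lt_neqAle (hp _ SC).1 ?andbT; last exact: DA.
  apply/eqP => gx; apply: Cx; rewrite (hp _ SC).2; split; [exact: DA|exact: esym].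
exists (y + x); first exact: DD.
by move=> C'; rewrite inE => /orP[/eqP|] h; apply: xlt; [right|left].
Qed.

Lemma exposed_linearity_domain S g C : is_fan S -> S C ->
  exposed (fan_support S) g C -> linearity_domain (fan_support S) g C.
Proof.
move=> [_ _ Sr _ _] SC [p _ CE]; split.
- by apply: rational_cone_convex; have [] := Sr C SC.
- by rewrite CE => x [].
- by exists p => x; rewrite {1}CE => -[].
Qed.

Lemma exposed_strictly_convex S g : is_fan S -> convex_cone (fan_support S) ->
  (forall C, S C -> exposed (fan_support S) g C) -> strictly_convex S g.
Proof.
move=> Sfan [_ AD _] Sexp; have Sf : finite_set S by case: Sfan.
split=> [x y Ax Ay|D].
  have [C SC Cxy] := AD _ _ Ax Ay; have [p pg CE] := Sexp _ SC.
  move: Cxy; rewrite CE => -[_ /= ->].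
  by rewrite pairingDr lerD ?pg.
split=> [[SD Dmax]|[Dlin Dmax]].
  split; first exact: exposed_linearity_domain (Sexp _ SD).
  move=> D' /(linearity_domain_sub Sf Sexp)[C SC D'C] DD'.
  apply/seteqP; split=> // x D'x; rewrite -(Dmax C) //; first exact: D'C.
  exact: subset_trans D'C.
have [C SC DC] := linearity_domain_sub Sf Sexp Dlin.
have lin C' : S C' -> linearity_domain (fan_support S) g C'.
  by move=> SC'; exact: exposed_linearity_domain (Sexp _ SC').
have <- : C = D by apply: Dmax => //; exact: lin.
split=> // C' SC' CC'; rewrite (Dmax C')//; last exact: subset_trans CC'.
  by rewrite (Dmax C)//; exact: lin.
exact: lin.
Qed.

End Exposed.

(** * Complete fans *)

Section CompleteFan.
Context {R : realType} {d : nat}.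
Implicit Types (A C D : set 'rV[R]_d) (g h : 'rV[R]_d -> R).
Implicit Types (S : set (set 'rV[R]_d)) (x y z m u : 'rV[R]_d).

Definition homogeneous g : Prop := forall t x, 0 <= t -> g (t *: x) = t * g x.

Lemma piecewise_linear_homogeneous S g : is_fan S -> fan_support S = setT ->
  piecewise_linear S g -> homogeneous g.
Proof.
move=> [_ _ Sr _ _] ST Sg t x t0.
have [C SC Cx] : fan_support S x by rewrite ST.
have [m gm] := Sg _ SC.
have [_ _ CZ] := rational_cone_convex (Sr _ SC).1.
by rewrite !gm ?pairingZr//; exact: CZ.
Qed.

Definition full_dim C : Prop :=
  forall m, (forall x, C x -> pairing m x = 0) -> m = 0.

(** A small multiple of a vector that is not orthogonal to the next cone is
    added to the direction found so far. *)
Lemma generic_direction (s : seq (set 'rV[R]_d)) : exists z, forall C, C \in s ->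
  ~ full_dim C -> exists2 m, (forall x, C x -> pairing m x = 0) & pairing m z <> 0.
Proof.
elim: s => [|C s [z hz]]; first by exists 0.
have [Cf|/existsNP[m /not_implyP[Cm m0]]] := pselect (full_dim C).
  by exists z => C'; rewrite inE => /orP[/eqP->//|]; exact: hz.
have [mz|mz] := eqVneq (pairing m z) 0; last first.
  exists z => C'; rewrite inE => /orP[/eqP->_|]; last exact: hz.
  by exists m => //; exact/eqP.
have : \forall t \near 0^'+, forall C', C' \in s -> ~ full_dim C' ->
    exists2 m', (forall x, C' x -> pairing m' x = 0) &
      pairing m' (z + t *: m) <> 0.
  apply: near_all_seq => C' C's.
  have [C'f|C'f] := pselect (full_dim C'); first by near=> t.
  have [m' C'm' /eqP] := hz C' C's C'f.
  rewrite neq_lt => /orP[|] m'z.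
    have : 0 < - pairing m' z by rewrite oppr_gt0.
    move=> /(near0_gt0 (- pairing m' m)); apply: filterS => t ht _.
    exists m' => //; apply/eqP; rewrite lt_eqF// pairingDr pairingZr.
    by rewrite -oppr_gt0 opprD -mulrN.
  move: m'z => /(near0_gt0 (pairing m' m)); apply: filterS => t ht _.
  by exists m' => //; apply/eqP; rewrite gt_eqF// pairingDr pairingZr.
move=> /near0_ex[t t0 ht]; exists (z + t *: m) => C'.
rewrite inE => /orP[/eqP->_|]; last exact: ht.
exists m => //; rewrite pairingDr pairingZr mz add0r; apply/eqP.
by rewrite mulf_neq0// gt_eqF//; exact: pairing_self_gt0.
Unshelve. all: by end_near.
Qed.

(** Move from [y] a little in a direction that lies in the span of no cone of
    smaller dimension: the cone containing the new point is full-dimensional,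
    and contains [y] because the finitely many cones are closed. *)
Lemma full_dim_cover S y : finite_set S -> (forall C, S C -> rational_cone C) ->
  fan_support S = setT -> exists2 C, S C & C y /\ full_dim C.
Proof.
move=> /finite_seqP[s Ss] Sr ST.
have [z hz] := generic_direction s.
have : \forall t \near 0^'+, forall C, C \in s -> C (y + t *: z) -> C y.
  apply: near_all_seq => C Cs.
  have [Cy|Cy] := pselect (C y); first by near=> t.
  have /rational_coneP[r rl CE] : rational_cone C by apply: Sr; rewrite Ss.
  have [qs _ qsP] := weyl rl.
  have [q [qq qy]] : exists q, q \in qs /\ pairing q y < 0.
    apply: contrapT => /forallNP hq; apply: Cy; rewrite CE; apply/qsP => q qq.
    by rewrite leNgt; apply/negP => qy; apply: (hq q).
  have : 0 < - pairing q y by rewrite oppr_gt0.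
  move=> /(near0_gt0 (- pairing q z)); apply: filterS => t ht.
  rewrite CE => /qsP/(_ q qq); rewrite leNgt pairingDr pairingZr.
  by rewrite -oppr_gt0 opprD -mulrN ht.
move=> /near0_ex[t t0 ht].
have [C SC Cyz] : fan_support S (y + t *: z) by rewrite ST.
have Cs : C \in s by rewrite Ss in SC.
exists C => //; split; first exact: ht Cyz.
apply: contrapT => /(hz C Cs)[m Cm /eqP/negP]; apply.
have := Cm _ Cyz; rewrite pairingDr pairingZr (Cm y) ?add0r; last exact: ht.
by move=> /eqP; rewrite mulf_eq0 gt_eqF.
Unshelve. all: by end_near.
Qed.

Lemma full_dim_interior C x : rational_cone C -> full_dim C ->
  exists2 y, C y & exists2 t, 0 < t & C (y + t *: x).
Proof.
move=> Cr Cf; have [y Cy ry] := rational_relint Cr; exists y => //.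
have /rational_coneP[r rl CE] := Cr; have [qs _ qsP] := weyl rl.
have qC q u : q \in qs -> C u -> 0 <= pairing q u.
  by move=> qq; rewrite CE => /qsP; apply.
apply: near0_ex.
have : \forall t \near 0^'+, forall q, q \in qs -> 0 <= pairing q (y + t *: x).
  apply: near_all_seq => q qq.
  have := qC q y qq Cy; rewrite le_eqVlt => /orP[/eqP qy|].
    have -> : q = 0 by apply: Cf; apply: ry => // u; exact: qC.
    by near=> t; rewrite pairing0l.
  move=> /(near0_gt0 (pairing q x)); apply: filterS => t /ltW.
  by rewrite pairingDr pairingZr.
by apply: filterS => t ht; rewrite CE; apply/qsP.
Unshelve. all: by end_near.
Qed.

(** Any direction [x] can be followed a little from an interior point of [C]
    without leaving [C]; convexity along that step compares [g x] with the slope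
    of the linear piece. *)
Lemma full_dim_lower_bound C g m : rational_cone C -> full_dim C ->
  convex_on setT g -> homogeneous g -> (forall x, C x -> g x = pairing m x) ->
  forall x, pairing m x <= g x.
Proof.
move=> Cr Cf gc gh gm x; have [y Cy [t t0 Cyx]] := full_dim_interior x Cr Cf.
have := gc y (t *: x) I I.
rewrite gh ?(ltW t0)// (gm _ Cy) (gm _ Cyx).
by rewrite pairingDr lerD2l pairingZr ler_pM2l.
Qed.

(** The two cones meet in a face of [C'], and a face that contains a point of the
    relative interior of [C'] is [C'] itself. *)
Lemma fan_relint_face S C C' y : is_fan S -> S C -> S C' -> C y -> C' y ->
  (forall m, (forall u, C' u -> 0 <= pairing m u) -> pairing m y = 0 ->
    forall u, C' u -> pairing m u = 0) -> cone_face C' C.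
Proof.
move=> [_ _ _ _ SI] SC SC' Cy C'y ry.
have [CC' [m [m0 mE]]] := SI _ _ SC SC'.
have my : pairing m y = 0.
  have : (C `&` C') y by [].
  by rewrite mE => -[].
suff <- : C `&` C' = C' by [].
rewrite mE; apply/seteqP; split=> [u []//|u C'u].
by split=> //; exact: ry.
Qed.

Lemma cone_face_sub F C : cone_face F C -> F `<=` C.
Proof. by move=> [m [_ ->]] x []. Qed.

Lemma full_dim_maximal S C : is_fan S -> S C -> full_dim C -> maximal_for S C.
Proof.
move=> [_ _ _ _ SI] SC Cf; split=> // C' SC' CC'.
have [_ [m [_ mE]]] := SI _ _ SC SC'.
have CE : C `&` C' = C by exact: setIidl.
have m0 : m = 0 by apply: Cf => x; rewrite -CE mE => -[].
by rewrite -CE mE m0; apply/seteqP; split=> x => [Cx|[]//]; split; rewrite //= pairing0l.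
Qed.

Lemma convex_cone_lower_bound g p : convex_on setT g -> homogeneous g ->
  (forall x, pairing p x <= g x) -> convex_cone [set x | g x = pairing p x].
Proof.
move=> gc gh pg; split=> [|x y /= gx gy|t x t0 /= gx].
- by rewrite /= pairing0r -(scale0r 0) gh// mul0r.
- by apply/eqP; rewrite eq_le pg andbT pairingDr -gx -gy; exact: gc.
- by rewrite gh// gx pairingZr.
Qed.

(** The linear form of [h] on a full-dimensional cone bounds [h] from below, and
    since such a cone is maximal, strict convexity says that it agrees with [h] on
    no larger set.  Any other cone is a face of one of these, cut out by some
    [m]: subtract a small multiple of [m] from the form.  Whether the result is
    still a lower bound is tested on the generators of the finitely many cones. *)
Lemma complete_fan_exposed S h : is_fan S -> fan_support S = setT ->
  piecewise_linear S h -> strictly_convex S h ->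
  forall C, S C -> exposed setT h C.
Proof.
move=> Sfan ST Sh [hc hmax] C' SC'.
have [Sf _ Sr SF SI] := Sfan; have hh := piecewise_linear_homogeneous Sfan ST Sh.
have {}Sr C : S C -> rational_cone C by move=> /Sr[].
rewrite ST in hc hmax.
have [y C'y ry] := rational_relint (Sr _ SC').
have [C SC [Cy Cf]] := full_dim_cover y Sf Sr ST.
have [m0 Ch] := Sh _ SC.
have lb := full_dim_lower_bound (Sr _ SC) Cf hc hh Ch.
have CE : [set x | h x = pairing m0 x] = C.
  have [/(_ (full_dim_maximal Sfan SC Cf))[_ Cmax] _] := hmax C.
  apply: Cmax; last by move=> x; exact: Ch.
  by split; [exact: convex_cone_lower_bound|by []|exists m0].
have fC := fan_relint_face Sfan SC SC' Cy C'y ry.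
have [m [mC C'E]] := fC.
have C'cc := rational_cone_convex (Sr _ SC').
have C'm u : C u -> pairing m u = 0 -> C' u by rewrite C'E.
have mC' u : C' u -> pairing m u = 0 by rewrite C'E => -[].
have C'C := cone_face_sub fC.
have /finite_seqP[s Ss] := Sf.
have : \forall t \near 0^'+, forall C2, C2 \in s -> forall x, C2 x ->
    pairing (m0 - t *: m) x <= h x /\ (h x = pairing (m0 - t *: m) x -> C' x).
  apply: near_all_seq => C2 C2s.
  have SC2 : S C2 by rewrite Ss.
  have [m2 hm2] := Sh _ SC2; have /rational_coneP[r rl C2E] := Sr _ SC2.
  have rC2 u : u \in r -> C2 u by move=> ur; rewrite C2E; exact: cone_gen.
  have : \forall t \near 0^'+, forall u, u \in r ->
      0 <= pairing (m2 - (m0 - t *: m)) u /\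
      (pairing (m2 - (m0 - t *: m)) u = 0 -> C' u).
    apply: near_all_seq => u ur.
    have E t : pairing (m2 - (m0 - t *: m)) u = h u - pairing m0 u + t * pairing m u.
      by rewrite !pairingE (hm2 u (rC2 u ur)); ring.
    have := lb u; rewrite le_eqVlt => /orP[/eqP hu|hu].
      have Cu : C u by rewrite -CE /=.
      near=> t; have t0 : 0 < t by [].
      rewrite E hu subrr add0r; split; first by rewrite mulr_ge0 ?mC// ltW.
      by move=> /eqP; rewrite mulf_eq0 gt_eqF//= => /eqP/(C'm _ Cu).
    have : 0 < h u - pairing m0 u by rewrite subr_gt0.
    move=> /(near0_gt0 (pairing m u)); apply: filterS => t; rewrite -E => ht.
    by split; [exact: ltW|move=> h0; rewrite h0 ltxx in ht].
  apply: filterS => t ht x C2x; have := C2x; rewrite C2E => rx.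
  have ge0 : forall u, [set` r] u -> 0 <= pairing (m2 - (m0 - t *: m)) u.
    by move=> u /ht[].
  rewrite -subr_ge0 hm2// -pairingBl; split; first exact: cone_ge0 rx.
  move=> xE; have x0 : pairing (m2 - (m0 - t *: m)) x = 0.
    by rewrite pairingBl xE subrr.
  apply: cone_min (cone_slack ge0 rx x0) => // u [/ht[_ hu]]; exact: hu.
move=> /near0_ex[t t0 ht]; exists (m0 - t *: m) => [x _|].
  have [C2 SC2 C2x] : fan_support S x by rewrite ST.
  by have [] := ht C2 _ x C2x; first by rewrite Ss in SC2.
rewrite setTI; apply/seteqP; split=> x.
  by move=> C'x; rewrite /= pairingBl pairingZl mC'// mulr0 subr0 Ch//; exact: C'C.
have [C2 SC2 C2x] : fan_support S x by rewrite ST.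
by have [] := ht C2 _ x C2x; first by rewrite Ss in SC2.
Unshelve. all: by end_near.
Qed.

End CompleteFan.

Section NormalizedRays.
Context {R : realType} {d : nat}.
Implicit Types (S : set (set 'rV[R]_d)) (N : 'rV[R]_d -> R).

(** Ray generators normalised by the value of [N], which replaces primitivity.
    For [N] the support function of a reflexive polytope, the lattice points of
    the boundary of the polar are the lattice points where [N] is one. *)
Definition unit_rays N S : set 'rV[R]_d :=
  [set v | [/\ lattice v, N v = 1 & S (ray v)]].

Lemma unit_rays_generate N S : is_fan S ->
  (forall C, S C -> is_ray C ->
    exists p : 'rV[R]_d, [/\ lattice p, N p = 1 & C = ray p]) ->
  forall C, S C -> C = cone (unit_rays N S `&` C).
Proof.
move=> [_ _ Sr SF _] SN C SC; have [Cr Cs] := Sr _ SC.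
have CC := rational_cone_convex Cr.
have [s [sl CE sF]] := strongly_convex_extreme Cr Cs.
apply/seteqP; split=> x; last by move=> /cone_min; apply=> // u [].
rewrite {1}CE => /cone_min; apply; first exact: convex_cone_cone.
move=> u /= us; have [u0 uF] := sF u us.
have Su : S (ray u) := SF _ _ SC uF.
have [|p [pl Np uE]] := SN _ Su; first by exists u.
have [t t0 ->] : ray p u by rewrite -uE; exists 1; rewrite ?scale1r.
apply: coneZ => //; apply: cone_gen; split; first by split; rewrite -?uE.
apply: (cone_face_sub uF); rewrite uE; exists 1 => //.
by rewrite scale1r.
Qed.

Lemma finite_unit_rays N S : finite_set S -> homogeneous N ->
  finite_set (unit_rays N S).
Proof.
move=> Sf Nh; have inj : {in unit_rays N S &, injective ray}.
  move=> v w /set_mem[_ Nv _] /set_mem[_ Nw _] vw.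
  have [t t0 vE] : ray w v by rewrite -vw; exists 1; rewrite ?scale1r.
  by move: Nv; rewrite vE Nh// Nw mulr1 => ->; rewrite scale1r.
rewrite -(eq_finite_set (inj_card_eq inj)).
by apply: sub_finite_set Sf => _ [v [_ _ Sv] <-].
Qed.
End NormalizedRays.

(** * Lattice polytopes and Minkowski sums *)

Section Polytope.
Context {R : realType} {d : nat}.
Implicit Types (A P : set 'rV[R]_d) (x y v a : 'rV[R]_d).

Lemma conv_hull_gen A a : A a -> conv_hull A a.
Proof.
by move=> Aa; exists 1%N, (fun=> a), (fun=> 1); rewrite !big_ord1 scale1r.
Qed.

Lemma conv_hull_ge A (b : R) y : (forall a, A a -> b <= pairing a y) ->
  forall x, conv_hull A x -> b <= pairing x y.
Proof.
move=> Ab x [k [p [w [Ap w0 w1 ->]]]].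
rewrite pairing_suml -[b]mul1r -w1 mulr_suml; apply: ler_sum => i _.
by rewrite pairingZl ler_wpM2l// Ab.
Qed.

Lemma polytope_face A y : finite_set A -> conv_hull A !=set0 ->
  exists2 a, A a & polyhedron_face (conv_hull A) y a.
Proof.
move=> /finite_seqP[s ->] [x [k [p [w [Ap w0 w1 _]]]]].
have sN : s != [::].
  apply/eqP => s0; case: k => [|k] in p w Ap w0 w1 *.
    by move: w1; rewrite big_ord0 => /eqP; rewrite eq_sym oner_eq0.
  by have := Ap ord0; rewrite s0.
have [a sa amax] := seq_argmax (fun a => - pairing a y) sN.
exists a => //; split; first exact: conv_hull_gen.
by apply: conv_hull_ge => b /amax; rewrite lerN2.
Qed.

Lemma lattice_polytope_face P y : lattice_polytope P -> P !=set0 ->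
  exists2 a, lattice a & polyhedron_face P y a.
Proof.
move=> [A [Af Al ->]] P0; have [a Aa fa] := polytope_face y Af P0.
by exists a => //; exact: Al.
Qed.

(** Separation, stated contrapositively.  The separating form comes from Weyl's
    theorem for the cone over the polytope placed at height one. *)
Lemma polytope_separation P v : lattice_polytope P ->
  (forall y, exists2 x, P x & pairing x y <= pairing v y) -> P v.
Proof.
move=> [A [/finite_seqP[s ->] Al ->]] hv.
pose s' := [seq extend a 1 | a <- s].
have [v' /mapP[a sa ->]|qs _ qsP] := @weyl _ _ s'.
  by apply: lattice_extend; [exact: Al|exact: rpred1].
have : cone [set` s'] (extend v 1).
  apply/qsP => q qq; have [x Px xv] := hv (lsubmx q).
  rewrite -(extendK q) pairing_extend mulr1.
  rewrite -lerBlDr sub0r pairingC; apply: le_trans xv.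
  apply: conv_hull_ge Px => a sa.
  have : cone [set` s'] (extend a 1).
    by apply: cone_gen; apply/mapP; exists a.
  move=> /qsP/(_ q qq); rewrite -{1}(extendK q) pairing_extend mulr1 pairingC.
  by rewrite -lerBlDr sub0r.
move=> /coneP_seq[w w0 vE]; exists (size s'), (fun i => lsubmx s'`_i), w.
have s'E (i : 'I_(size s')) : exists2 a, a \in s & s'`_i = extend a 1.
  by have /mapP := mem_nth 0 (ltn_ord i).
split=> // [i||].
- by have [a sa ->] := s'E i; rewrite lsubmx_extend.
- have := congr1 (@last_coord _ _) vE; rewrite last_extend => ->.
  rewrite (big_morph _ (@last_coordD _ _) (@last_coord0 _ _)).
  apply: eq_bigr => i _; have [a _ ->] := s'E i.
  by rewrite last_coordZ last_extend mulr1.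
- have := congr1 lsubmx vE; rewrite lsubmx_extend => ->.
  by rewrite linear_sum; apply: eq_bigr => i _; rewrite linearZ.
Qed.

Lemma support_fun_homogeneous P :
  (forall y, polyhedron_face P y !=set0) -> homogeneous (support_fun P).
Proof.
move=> Pf t y t0; have [x [Px xmin]] := Pf y.
have fx : polyhedron_face P (t *: y) x.
  by split=> // x' Px'; rewrite !pairingZr ler_wpM2l// xmin.
have fy : polyhedron_face P y x by [].
by rewrite (support_fun_face fx) (support_fun_face fy) pairingZr mulrN.
Qed.

Lemma support_fun_convex P :
  (forall y, polyhedron_face P y !=set0) -> convex_on setT (support_fun P).
Proof.
move=> Pf y z _ _; have [x fx] := Pf (y + z); have [x1 f1] := Pf y.
have [x2 f2] := Pf z.
rewrite (support_fun_face fx) (support_fun_face f1) (support_fun_face f2).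
rewrite pairingDr opprD lerD// lerN2; first by apply: f1.2; exact: fx.1.
by apply: f2.2; exact: fx.1.
Qed.

Lemma support_fun_ge P x y : polyhedron_face P y !=set0 -> P x ->
  - pairing x y <= support_fun P y.
Proof.
by move=> [x' fx'] Px; rewrite (support_fun_face fx') lerN2; exact: fx'.2.
Qed.

Lemma fan_support_normal_fan P : (forall y, polyhedron_face P y !=set0) ->
  fan_support (normal_fan P) = setT.
Proof.
move=> Pf; apply/seteqP; split=> // y _.
by exists (normal_cone P (polyhedron_face P y)); [exists y|].
Qed.

Lemma interior0_neg P y : interior P 0 -> y <> 0 ->
  exists2 x, P x & pairing x y < 0.
Proof.
move=> P0 y0.
have cy : (fun t : R => t *: (- y)) @ (0 : R) --> (0 : 'rV[R]_d).
  rewrite -[X in _ --> X](scale0r (- y)).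
  by apply: cvgZr_tmp; exact: cvg_id.
have /nbhs_ballP[e /= e0 eP] := cy _ P0.
exists ((e / 2) *: (- y)); last first.
  rewrite pairingZl pairingNl mulrN oppr_lt0 mulr_gt0 ?divr_gt0//.
  exact: pairing_self_gt0.
apply: (eP (e / 2)); rewrite /ball /= sub0r normrN gtr0_norm ?divr_gt0//.
by rewrite ltr_pdivrMr// ltr_pMr// ltr1n.
Qed.

End Polytope.

Section Minkowski.
Context {R : realType} {d r : nat}.
Variable P : 'I_r -> set 'rV[R]_d.

Lemma minkowski_face (p : 'I_r -> 'rV[R]_d) y :
  (forall i, polyhedron_face (P i) y (p i)) ->
  polyhedron_face (minkowski_sum P) y (\sum_i p i).
Proof.
move=> fp; split; first by exists p; split=> // i; exact: (fp i).1.
move=> _ [q [Pq ->]]; rewrite !pairing_suml; apply: ler_sum => i _.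
exact: (fp i).2.
Qed.

Lemma minkowski_face_part (p : 'I_r -> 'rV[R]_d) y : (forall i, P i (p i)) ->
  polyhedron_face (minkowski_sum P) y (\sum_i p i) ->
  forall i, polyhedron_face (P i) y (p i).
Proof.
move=> Pp [_ pmin] i; split=> // x Px.
pose q j := if j == i then x else p j.
have qE : \sum_j q j = x + \sum_(j | j != i) p j.
  rewrite (bigD1 i)//= /q eqxx; congr (_ + _).
  by apply: eq_bigr => j /negbTE ->.
have : minkowski_sum P (\sum_j q j).
  by exists q; split=> // j; rewrite /q; case: eqP => // ->.
by move=> /pmin; rewrite qE (bigD1 i)//= !pairingDl lerD2r.
Qed.

Lemma minkowski_support_fun y : (forall i, polyhedron_face (P i) y !=set0) ->
  support_fun (minkowski_sum P) y = \sum_i support_fun (P i) y.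
Proof.
move=> /choice[p fp]; rewrite (support_fun_face (minkowski_face fp)).
by rewrite pairing_suml -sumrN; apply: eq_bigr => i _; rewrite (support_fun_face (fp i)).
Qed.

End Minkowski.

Lemma int_mul_nat_eq1 (R : realType) (k : nat) (a : R) : a \is a Num.int ->
  k%:R * a = 1 -> k = 1%N.
Proof.
move=> /intrP[z ->] /eqP; rewrite -[k%:R]/(k%:~R) -intrM -[1]/(1%:~R) eqr_int.
move=> /eqP/(congr1 absz); rewrite abszM /= => /eqP.
by rewrite muln_eq1 => /andP[/eqP].
Qed.

(** * Reflexive polytopes *)

Section Reflexive.
Context {R : realType} {d : nat}.
Variable Delta : set 'rV[R]_d.
Hypothesis hDelta : reflexive_polytope Delta.
Implicit Types (x y e u : 'rV[R]_d).

Lemma reflexive_face y :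
  exists2 x, lattice x & polyhedron_face Delta y x.
Proof.
have [Dp D0 _] := hDelta; apply: lattice_polytope_face => //.
by exists 0; exact: interior_subset D0.
Qed.

Lemma reflexive_face_neq0 y : polyhedron_face Delta y !=set0.
Proof. by have [x _ fx] := reflexive_face y; exists x. Qed.

Lemma reflexive_support_gt0 y : y <> 0 -> 0 < support_fun Delta y.
Proof.
have [_ D0 _] := hDelta; move=> /(interior0_neg D0)[x Dx xy].
apply: lt_le_trans (support_fun_ge (reflexive_face_neq0 y) Dx).
by rewrite oppr_gt0.
Qed.

Lemma reflexive_support_int y : lattice y -> support_fun Delta y \is a Num.int.
Proof.
move=> yl; have [x xl fx] := reflexive_face y.
by rewrite (support_fun_face fx) rpredN pairing_int.
Qed.

Lemma polar_support y : polar Delta y <-> support_fun Delta y <= 1.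
Proof.
have [x _ fx] := reflexive_face y; rewrite (support_fun_face fx).
split=> [/(_ _ fx.1)|xy z Dz]; first by rewrite lerNl.
by apply: le_trans (fx.2 z Dz); rewrite lerNl.
Qed.

(** The bipolar theorem: a multiple of any nonzero [y] lies on the boundary of
    the polar, hence is a convex combination of the lattice points [B]; so the
    inequalities for [B] imply the one for [y]. *)
Lemma reflexive_polyh : exists B : set 'rV[R]_d,
  [/\ finite_set B, B `<=` lattice & Delta = polyh B (fun=> 1)].
Proof.
have [Dp D0 [B [Bf Bl BE]]] := hDelta; exists B; split=> //.
apply/seteqP; split=> x.
  move=> Dx u Bu; have : polar Delta u by rewrite BE; exact: conv_hull_gen.
  exact.
move=> hx; apply: polytope_separation => // y.
have [a _ fa] := reflexive_face y; exists a; first exact: fa.1.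
have [->|/eqP y0] := eqVneq y 0; first by rewrite !pairing0r.
have p0 := reflexive_support_gt0 y0.
set s := support_fun Delta y in p0.
have : polar Delta (s^-1 *: y).
  apply/polar_support.
  rewrite (support_fun_homogeneous reflexive_face_neq0) ?invr_ge0 ?(ltW p0)//.
  by rewrite mulVf// gt_eqF.
rewrite BE => By.
have xB b : B b -> -1 <= pairing b x by rewrite pairingC; exact: hx.
have := conv_hull_ge xB By; rewrite pairingZl ler_pdivlMl// mulrN1 pairingC.
by rewrite /s (support_fun_face fa) opprK.
Qed.

Lemma reflexive_normal_fan : is_fan (normal_fan Delta).
Proof.
have [B [Bf Bl DE]] := reflexive_polyh.
have h0 u : B u -> - (fun=> 1 : R) u < pairing 0 u :> R.
  by move=> _; rewrite pairing0l oppr_lt0.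
rewrite DE normal_fan_polyh//; first exact: act_fan_is_fan h0.
by exists 0 => u /h0/ltW.
Qed.

(** A ray of the normal fan is generated by an inequality of the lattice
    description, and these are at distance one from the origin. *)
Lemma reflexive_ray_point C : normal_fan Delta C -> is_ray C ->
  exists p : 'rV[R]_d, [/\ lattice p, support_fun Delta p = 1 & C = ray p].
Proof.
have [B [Bf Bl DE]] := reflexive_polyh.
rewrite {1}DE normal_fan_polyh//; last by exists 0 => u _; rewrite pairing0l oppr_le0.
move=> [x hx <-] [e e0 CE].
have [u au] : active B (fun=> 1) x !=set0.
  apply/set0P/eqP => a0; apply: e0; apply: cone_set0.
  rewrite -a0 -[cone _]/(act_cone _ _ _) CE.
  by exists 1; rewrite ?scale1r.
have pu : support_fun Delta u = 1.
  by rewrite DE (support_act_cone hx (cone_gen au)) au.2 opprK.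
exists u; split=> //; first exact: Bl au.1.
have [t t0 uE] : ray e u by rewrite -CE; exact: cone_gen.
rewrite CE; apply/esym; apply: (ray_eq _ uE).
rewrite lt0r t0 andbT; apply/eqP => t00; move: pu.
rewrite uE t00 scale0r -(scale0r 0) support_fun_homogeneous//.
  by rewrite mul0r => /eqP; rewrite eq_sym oner_eq0.
exact: reflexive_face_neq0.
Qed.

Lemma reflexive_homogeneous : homogeneous (support_fun Delta).
Proof. exact: support_fun_homogeneous reflexive_face_neq0. Qed.

Lemma reflexive_ray_generators :
  ray_generators (normal_fan Delta) =
  unit_rays (support_fun Delta) (normal_fan Delta).
Proof.
apply/seteqP; split=> e.
  move=> [[el e0 ep] Se].
  have [|u [ul u1 eu]] := reflexive_ray_point Se; first by exists e.
  have [t t0 eE] : ray u e by rewrite -eu; exists 1; rewrite ?scale1r.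
  have et : support_fun Delta e = t by rewrite eE reflexive_homogeneous// u1 mulr1.
  have /natrP[k kE] : t \is a Num.nat.
    by rewrite natrEint t0 -et reflexive_support_int.
  have k1 : k = 1%N by apply: (ep k u) => //; rewrite eE kE scaler_nat.
  by split; rewrite // et kE k1.
move=> [el e1 Se]; split=> //; split=> // [e0|k u ul eE].
  move: e1; rewrite e0 -(scale0r 0) reflexive_homogeneous// mul0r => /eqP.
  by rewrite eq_sym oner_eq0.
apply: (int_mul_nat_eq1 (reflexive_support_int ul)).
by rewrite -reflexive_homogeneous ?ler0n// scaler_nat -eE.
Qed.

Lemma normal_fan_rays C : normal_fan Delta C ->
  C = cone (ray_generators (normal_fan Delta) `&` C).
Proof.
rewrite reflexive_ray_generators; apply: unit_rays_generate.
- exact: reflexive_normal_fan.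
- exact: reflexive_ray_point.
Qed.

Lemma normal_fan_point y : exists x, [/\ lattice x, polyhedron_face Delta y x &
  exists C, [/\ normal_fan Delta C, C y &
    forall z, C z -> polyhedron_face Delta z x]].
Proof.
have [x xl fx] := reflexive_face y; exists x; split=> //.
exists (normal_cone Delta (polyhedron_face Delta y)); split=> //.
  by exists y; split=> //; exists x.
by move=> z /(_ x fx).
Qed.

(** Both functions are linear on the cones of the normal fan and take the value
    one at their ray generators. *)
Lemma support_fun_unique phi : piecewise_linear (normal_fan Delta) phi ->
  (forall e, ray_generators (normal_fan Delta) e -> phi e = 1) ->
  phi = support_fun Delta.
Proof.
move=> phil phi1; apply/funext => y.
have [x [_ fx [C [SC Cy Cx]]]] := normal_fan_point y.
have [m hm] := phil _ SC.
rewrite (support_fun_face fx) hm// -pairingNl.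
move: Cy; rewrite {1}(normal_fan_rays SC); apply: cone_eq => u [eu Cu].
rewrite -hm// phi1// pairingNl -(support_fun_face (Cx _ Cu)).
by move: eu; rewrite reflexive_ray_generators => -[].
Qed.

(** Reduces the inequalities of a point [v] to the ray generators, where a
    nef-partition prescribes the support functions. *)
Lemma normal_fan_compare C x v y : normal_fan Delta C -> C y ->
  (forall e, ray_generators (normal_fan Delta) e -> C e ->
    pairing x e <= pairing v e) -> pairing x y <= pairing v y.
Proof.
move=> SC + h; rewrite (normal_fan_rays SC) => hy.
rewrite -subr_ge0 -pairingBl; apply: cone_ge0 hy => e [Ge Ce].
by rewrite pairingBl subr_ge0 h.
Qed.

End Reflexive.

Section Subdivision.
Context {R : realType} {d : nat}.
Variables (Delta : set 'rV[R]_d) (S : set (set 'rV[R]_d)).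
Hypothesis hDelta : reflexive_polytope Delta.
Hypothesis hS : partial_crepant_resolution (polar Delta) (normal_fan Delta) S.
Implicit Types (x y v : 'rV[R]_d).

Lemma subdivision_complete : fan_support S = setT.
Proof.
have [[_ -> _] _] := hS; apply: fan_support_normal_fan.
exact: reflexive_face_neq0 hDelta.
Qed.

(** Linearity of the support function on [C], in the form of a common minimiser. *)
Lemma subdivision_point C : S C -> exists2 x, lattice x &
  forall y, C y -> polyhedron_face Delta y x.
Proof.
have [[_ _ sub] _] := hS; move=> /sub[_ [y [_ ->]] CC].
have [x xl fx] := reflexive_face hDelta y; exists x => // z /CC; exact.
Qed.

Lemma subdivision_rays C : S C ->
  C = cone (unit_rays (support_fun Delta) S `&` C).
Proof.
have [[Sfan _ _] Sray] := hS; apply: unit_rays_generate => // {}C SC rC.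
have [p [pl [/(polar_support hDelta) p1 _] CE]] := Sray _ SC rC; exists p; split=> //.
have p0 : p <> 0.
  move=> p0; have [e e0 eE] := rC; apply: e0.
  have [t _ ->] : ray p e by rewrite -CE eE; exists 1; rewrite ?scale1r.
  by rewrite p0 scaler0.
have /natrP[k kE] : support_fun Delta p \is a Num.nat.
  by rewrite natrEint reflexive_support_int//= ltW// reflexive_support_gt0.
have := reflexive_support_gt0 hDelta p0; move: p1; rewrite kE.
by rewrite ltr0n -[X in _ <= X]/(1%:R) ler_nat; case: k {kE} => [|[]].
Qed.

Lemma subdivision_inequalities v :
  (forall e, unit_rays (support_fun Delta) S e -> -1 <= pairing v e) -> Delta v.
Proof.
move=> hv; apply: polytope_separation; first by case: hDelta.
move=> y; have [C SC Cy] : fan_support S y by rewrite subdivision_complete.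
have [x _ fx] := subdivision_point SC; exists x; first exact: (fx _ Cy).1.
move: (Cy); rewrite {1}(subdivision_rays SC) => hy.
rewrite -subr_ge0 -pairingBl; apply: cone_ge0 hy => e [Ge Ce].
rewrite pairingBl subr_ge0; have := hv e Ge; apply: le_trans.
rewrite lerNr -(support_fun_face (fx _ Ce)).
by case: Ge => _ ->.
Qed.

End Subdivision.

Lemma sum_nat_eq1 (R : realType) (r : nat) (f : 'I_r -> R) :
  (forall i, f i \is a Num.nat) -> \sum_i f i = 1 ->
  exists i, forall j, f j = (j == i)%:R.
Proof.
move=> fn f1; have [i fi] : exists i, f i != 0.
  apply: contrapT => /forallNP h; move: f1; rewrite big1 => [/eqP|i _].
    by rewrite eq_sym oner_eq0.
  by apply/eqP; apply: contrapT => /negP; exact: h.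
have f0 j : 0 <= f j by have /natrP[k ->] := fn j.
have fi1 : 1 <= f i.
  by have /natrP[k kE] := fn i; move: fi; rewrite kE pnatr_eq0 -lt0n ler1n.
have s0 : 0 <= \sum_(j | j != i) f j by exact: sumr_ge0.
move: f1; rewrite (bigD1 i)//= => f1.
have {}fi : f i = 1 by lra.
have /eqP : \sum_(j | j != i) f j = 0 by lra.
rewrite psumr_eq0 => [/allP h|//]; exists i => j.
case: eqVneq => [->//|ji]; have := h j (mem_index_enum _).
by rewrite ji => /eqP.
Qed.

(** * Nef-partitions *)

Section NefPartition.
Context {R : realType} {d r : nat}.
Variables (Delta : set 'rV[R]_d) (D : 'I_r -> set 'rV[R]_d).
Hypotheses (hDelta : reflexive_polytope Delta) (hnef : nef_partition Delta D).
Implicit Types (x y v e : 'rV[R]_d) (i j : 'I_r).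

Let E := ray_generators (normal_fan Delta).

Lemma nef_part_face i y : exists2 x, lattice x & polyhedron_face (D i) y x.
Proof.
have [Dl DE _] := hnef; apply: lattice_polytope_face => //.
have [x [x0 _]] := reflexive_face_neq0 hDelta 0; move: x0.
by rewrite DE => -[p [Dp _]]; exists (p i).
Qed.

Lemma nef_part_face_neq0 i y : polyhedron_face (D i) y !=set0.
Proof. by have [x _ fx] := nef_part_face i y; exists x. Qed.

(** The support functions of the parts take the values zero and one at a ray
    generator, and add up to the one of [Delta], whose value there is one. *)
Lemma nef_color e : E e -> exists i, forall j, support_fun (D j) e = (j == i)%:R.
Proof.
have [_ DE D01] := hnef; move=> Ee; apply: sum_nat_eq1 => [i|].
  by have [->|->] := D01 i e Ee; rewrite ?rpred0 ?rpred1.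
rewrite -minkowski_support_fun -?DE => [|i]; last exact: nef_part_face_neq0.
by move: Ee; rewrite /E reflexive_ray_generators// => -[].
Qed.

Lemma nef_part_inequalities i v :
  (forall e, E e -> - support_fun (D i) e <= pairing v e) -> D i v.
Proof.
have [Dl DE _] := hnef => hv; apply: polytope_separation => // y.
have [x [_ [Dx _] [C [SC Cy Cx]]]] := normal_fan_point hDelta y.
move: Dx; rewrite DE => -[p [Dp xE]].
exists (p i) => //; apply: (normal_fan_compare hDelta SC Cy) => e Ee Ce.
have := Cx _ Ce; rewrite DE xE => /(minkowski_face_part Dp)/(_ i) fp.
by apply: le_trans (hv e Ee); rewrite (support_fun_face fp) opprK.
Qed.

Lemma nef_part0 i : D i 0.
Proof.
have [_ _ D01] := hnef; apply: nef_part_inequalities => e Ee.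
by rewrite pairing0l; have [->|->] := D01 i e Ee; rewrite ?oppr0// oppr_le0.
Qed.

Let A i := [set 0] `|` [set e | E e /\ support_fun (D i) e = 1].

Lemma nabla_part_finite i : finite_set (A i).
Proof.
rewrite finite_setU; split; first exact: finite_set1.
apply: (@sub_finite_set _ _ E) => [e []//|].
rewrite /E reflexive_ray_generators//; apply: finite_unit_rays.
  by have [] := reflexive_normal_fan hDelta.
exact: reflexive_homogeneous.
Qed.

Lemma nabla_part_lattice i : A i `<=` lattice.
Proof. by move=> e [->|[[[]]]//]; exact: lattice0. Qed.

Lemma nabla_part_face i y : exists2 x, lattice x &
  polyhedron_face (nabla_part Delta D i) y x.
Proof.
have [|x Ax fx] := polytope_face y (nabla_part_finite i).
  by exists 0; apply: conv_hull_gen; left.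
by exists x => //; exact: nabla_part_lattice Ax.
Qed.

Lemma nabla_part_face_neq0 i y : polyhedron_face (nabla_part Delta D i) y !=set0.
Proof. by have [x _ fx] := nabla_part_face i y; exists x. Qed.

Lemma nabla_support_fun y : support_fun (nabla Delta D) y = check_phi Delta D y.
Proof. by apply: minkowski_support_fun => i; exact: nabla_part_face_neq0. Qed.

Lemma nabla_face_neq0 y : polyhedron_face (nabla Delta D) y !=set0.
Proof.
have /choice[p fp] := fun i => nabla_part_face_neq0 i y.
by exists (\sum_i p i); exact: minkowski_face.
Qed.

Lemma check_phi_part_nat i v : lattice v ->
  support_fun (nabla_part Delta D i) v \is a Num.nat.
Proof.
move=> vl; rewrite natrEint; apply/andP; split.
  have [x xl fx] := nabla_part_face i v.
  by rewrite (support_fun_face fx) rpredN pairing_int.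
rewrite -[leLHS]oppr0 -(pairing0l v).
apply: support_fun_ge (nabla_part_face_neq0 i v) _.
by apply: conv_hull_gen; left.
Qed.

Lemma check_phi_part_gen i e v : E e -> support_fun (D i) e = 1 ->
  - pairing v e <= support_fun (nabla_part Delta D i) v.
Proof.
move=> Ee e1; rewrite pairingC.
apply: support_fun_ge (nabla_part_face_neq0 i v) _.
by apply: conv_hull_gen; right.
Qed.

Lemma check_phi_part_le i j v : D i v ->
  support_fun (nabla_part Delta D j) v <= (j == i)%:R.
Proof.
move=> Dv; have [|x Ax fx] := polytope_face v (nabla_part_finite j).
  by exists 0; apply: conv_hull_gen; left.
rewrite (@support_fun_face _ _ (nabla_part Delta D j) x v fx).
case: Ax => [->|[Ex x1]]; first by rewrite pairing0l oppr0 ler0n.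
rewrite pairingC.
apply: le_trans (support_fun_ge (nef_part_face_neq0 i x) Dv) _.
have [k hk] := nef_color Ex; move: x1; rewrite !hk.
case: eqVneq => [<- _|_ /eqP]; last by rewrite eq_sym oner_eq0.
by rewrite eq_sym.
Qed.

(** The values of the functions [check_phi_i] at such a lattice point are natural
    numbers of sum at most one; they cannot all vanish because the normal fan of
    [Delta] is complete.  The index with value one gives the part. *)
Lemma polar_nabla_color v : lattice v -> v <> 0 ->
  polar (nabla Delta D) v -> exists2 i, D i v &
    forall j, support_fun (nabla_part Delta D j) v = (j == i)%:R.
Proof.
move=> vl v0 pv.
have vn j := check_phi_part_nat j vl.
have s1 : \sum_j support_fun (nabla_part Delta D j) v <= 1.
  rewrite -[leLHS]/(check_phi Delta D v) -nabla_support_fun.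
  have [x fx] := nabla_face_neq0 v.
  by rewrite (support_fun_face fx) lerNl; apply: pv; exact: fx.1.
have sn : \sum_j support_fun (nabla_part Delta D j) v != 0.
  apply/eqP => /eqP; rewrite psumr_eq0 => [/allP h|j _]; last first.
    by have /natrP[k ->] := vn j.
  apply: v0; apply: pairing_self_eq0; apply/eqP; rewrite eq_le pairing_self_ge0 andbT.
  have [x [_ _ [C [SC Cv _]]]] := normal_fan_point hDelta (- v).
  rewrite -oppr_ge0 -pairingNr -(pairing0l (- v)).
  apply: (normal_fan_compare hDelta SC Cv) => e Ee _; rewrite pairing0l.
  have [j hj] := nef_color Ee.
  have e1 : support_fun (D j) e = 1 by rewrite hj eqxx.
  have := check_phi_part_gen v Ee e1.
  by have /eqP -> := h j (mem_index_enum _); rewrite oppr_le0.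
have [i hi] : exists i, forall j, support_fun (nabla_part Delta D j) v = (j == i)%:R.
  apply: sum_nat_eq1 => //.
  have /natrP[k kE] : \sum_j support_fun (nabla_part Delta D j) v \is a Num.nat.
    by apply: rpred_sum => j _; exact: vn.
  move: s1 sn; rewrite kE -[X in _ <= X]/(1%:R) ler_nat pnatr_eq0.
  by case: k {kE} => [|[]].
exists i => //; apply: nef_part_inequalities => e Ee.
have [j hj] := nef_color Ee; rewrite hj.
have e1 : support_fun (D j) e = 1 by rewrite hj eqxx.
by have := check_phi_part_gen v Ee e1; rewrite hi eq_sym lerNl.
Qed.

End NefPartition.

(** * The polyhedron [tilde_Delta] as an epigraph *)

Section CheckSide.
Context {R : realType} {d r : nat}.
Variables (Delta : set 'rV[R]_d) (D : 'I_r -> set 'rV[R]_d).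
Hypotheses (hDelta : reflexive_polytope Delta) (hnef : nef_partition Delta D).
Variables (cS : set (set 'rV[R]_d)) (ch : 'rV[R]_d -> R).
Hypothesis hcS : partial_crepant_resolution (polar (nabla Delta D))
  (normal_fan (nabla Delta D)) cS.
Hypothesis hch : integral_piecewise_linear cS ch.
Hypothesis hch' : convex_on setT (ch \- check_phi Delta D).
Implicit Types (x y v u m n : 'rV[R]_d) (i j : 'I_r).

Let N := check_phi Delta D.
Let hc := ch \- check_phi Delta D.
Let G := unit_rays N cS.

Lemma check_complete : fan_support cS = setT.
Proof.
have [[_ -> _] _] := hcS; apply: fan_support_normal_fan.
exact: nabla_face_neq0 D hDelta.
Qed.

Lemma check_phi_homogeneous : homogeneous N.
Proof.
move=> t x t0; rewrite /N -!nabla_support_fun//; apply: support_fun_homogeneous => //.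
exact: nabla_face_neq0 D hDelta.
Qed.

(** The functions [check_phi_j] are linear on the cones because a minimiser over a
    Minkowski sum is a sum of minimisers over the parts. *)
Lemma check_phi_linear C : cS C -> exists a : 'I_r -> 'rV[R]_d,
  [/\ forall j, lattice (a j), forall j, nabla_part Delta D j (a j) &
    forall x, C x -> forall j,
      support_fun (nabla_part Delta D j) x = - pairing (a j) x].
Proof.
have [[_ _ sub] _] := hcS; move=> /sub[_ [y [_ ->]] CC].
have /choice[a ha] : forall j, exists x, lattice x /\
    polyhedron_face (nabla_part Delta D j) y x.
  by move=> j; have [x xl fx] := nabla_part_face D hDelta j y; exists x.
exists a; split=> [j|j|x /CC Cx j]; [by case: (ha j)|by case: (ha j) => _ []|].
have fy : polyhedron_face (nabla Delta D) y (\sum_i a i).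
  by apply: minkowski_face => i; case: (ha i).
have := minkowski_face_part (P := nabla_part Delta D) (p := a) (y := x).
by move=> /(_ (fun i => (ha i).2.1) (Cx _ fy) j) /support_fun_face.
Qed.

Lemma check_rays_color v : G v -> exists2 i, D i v &
  forall j, support_fun (nabla_part Delta D j) v = (j == i)%:R.
Proof.
move=> [vl v1 _]; apply: polar_nabla_color => // [v0|x nx].
  move: v1; rewrite v0 -(scale0r 0) check_phi_homogeneous// mul0r => /eqP.
  by rewrite eq_sym oner_eq0.
rewrite lerNl -v1 /N -nabla_support_fun//; apply: support_fun_ge => //.
exact: nabla_face_neq0.
Qed.

Lemma check_rays C : cS C -> C = cone (G `&` C).
Proof.
have [[Sfan _ _] Sray] := hcS; apply: unit_rays_generate => // {}C SC rC.
have [p [pl [pp _] CE]] := Sray _ SC rC; exists p; split=> //.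
have p0 : p <> 0.
  move=> p0; have [e e0 eE] := rC; apply: e0.
  have [t _ ->] : ray p e by rewrite -CE eE; exists 1; rewrite ?scale1r.
  by rewrite p0 scaler0.
have [i _ hi] := polar_nabla_color hDelta hnef pl p0 pp.
rewrite /N /check_phi (bigD1 i)//= hi eqxx big1 ?addr0// => j /negbTE ji.
by rewrite hi ji.
Qed.

Lemma finite_check_rays : finite_set G.
Proof.
have [[[Sf _ _ _ _] _ _] _] := hcS.
by apply: finite_unit_rays => //; exact: check_phi_homogeneous.
Qed.

Lemma twisted_linear C : cS C ->
  exists2 n, lattice n & forall x, C x -> hc x = - pairing n x.
Proof.
move=> SC; have [a [al _ aE]] := check_phi_linear SC.
have [m ml mE] := hch SC; exists (- (m + \sum_j a j)).
  by apply: latticeN; apply: latticeD => //; exact: lattice_sum.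
move=> x Cx; rewrite /hc /= mE//.
have -> : check_phi Delta D x = - \sum_j pairing (a j) x.
  by rewrite -sumrN; apply: eq_bigr => j _; exact: aE.
by rewrite pairingNl pairingDl pairing_suml !opprK.
Qed.

Lemma twisted_homogeneous : homogeneous hc.
Proof.
have [[Sfan _ _] _] := hcS.
apply: (piecewise_linear_homogeneous Sfan check_complete) => C SC.
have [n _ nE] := twisted_linear SC; exists (- n) => x Cx.
by rewrite nE// pairingNl.
Qed.

(** The vertices of the twisted polytope: [hc] is the maximum of its linear
    pieces on the full-dimensional cones, and all its pieces are integral. *)
Lemma twisted_vertices : exists V : set 'rV[R]_d, [/\ finite_set V,
  V `<=` lattice, V `<=` nabla_twisted hc &
  forall x, exists2 v, V v & hc x = - pairing v x].
Proof.
have [[Sfan _ _] _] := hcS; have [Sf _ Sr _ _] := Sfan.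
have /choice[n hn] : forall C, exists n, cS C ->
    lattice n /\ forall x, C x -> hc x = - pairing n x.
  move=> C; have [SC|nSC] := pselect (cS C); last by exists 0.
  by have [n nl nE] := twisted_linear SC; exists n.
exists (n @` [set C | cS C /\ full_dim C]); split.
- by apply: finite_image; apply: sub_finite_set Sf => C [].
- by move=> _ [C [SC _] <-]; case: (hn _ SC).
- move=> _ [C [SC Cf] <-] x; rewrite lerNl pairingC -pairingNl.
  apply: (full_dim_lower_bound (Sr _ SC).1 Cf hch' twisted_homogeneous) => y Cy.
  by rewrite pairingNl; exact: (hn _ SC).2.
- move=> x; have Sr1 C (SC : cS C) := (Sr C SC).1.
  have [C SC [Cx Cf]] := full_dim_cover x Sf Sr1 check_complete.
  by exists (n C); [exists C|exact: (hn _ SC).2].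
Qed.

Lemma cone_split C x : cone (G `&` C) x -> exists2 p : 'I_r -> 'rV[R]_d,
  forall i, cone (G `&` C `&` D i) (p i) & x = \sum_i p i.
Proof.
elim=> [|t u z t0 [Gu Cu] _ [p pc ->]].
  by exists (fun=> 0) => [i|]; [exact: cone0|rewrite big1].
have [i0 Di0 _] := check_rays_color Gu.
exists (fun i => (if i == i0 then t *: u else 0) + p i) => [i|].
  apply: coneD => //; case: eqP => [->|_]; last exact: cone0.
  by apply: coneZ => //; exact: cone_gen.
by rewrite big_split/= -big_mkcond/= big_pred1_eq.
Qed.

(** Decomposition inside one cone.  Write [m] in the ray generators of a cone of
    [cS] and sort these by the part they belong to.  The sum [p i] of the terms in
    the [i]-th part has total weight [check_phi_i m], which is at most one since
    [m] also is a sum of points of the parts; so [p i] is in the convex hull of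
    zero and those generators.  That last fact is expressed by linear forms. *)
Lemma twisted_decomposition m : Delta m -> exists n (p : 'I_r -> 'rV[R]_d),
  [/\ m = \sum_i p i, hc m = - pairing n m,
    forall i, hc (p i) = - pairing n (p i) &
    forall i y b, b <= 0 ->
      (forall u, G u -> D i u -> hc u = - pairing n u -> b <= pairing u y) ->
      b <= pairing (p i) y].
Proof.
have [_ DE _] := hnef; rewrite {1}DE => -[q [Dq mE]].
have [C SC Cm] : fan_support cS m by rewrite check_complete.
have [n _ nE] := twisted_linear SC; have [a [_ aP aE]] := check_phi_linear SC.
have := Cm; rewrite {1}(check_rays SC) => /cone_split[p pc pE].
have pC i : C (p i).
  by rewrite (check_rays SC); apply: cone_mono (pc i) => u [].
exists n, p; split=> // [|i|i y b b0 hb]; [exact: nE|exact: nE|].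
have aG j u : G u -> C u -> D j u -> forall k, - pairing (a k) u = (k == j)%:R.
  move=> Gu Cu Dju k; rewrite -(aE _ Cu).
  have [j' _ hj'] := check_rays_color Gu.
  have := check_phi_part_le hDelta hnef j' Dju; rewrite !hj' eqxx.
  by case: (j' =P j) => [->//|_]; rewrite ler10.
have ap j : j != i -> pairing (a i) (p j) = 0.
  move=> ji; rewrite -(pairing0l (p j)); apply: cone_eq (pc j) => u [[Gu Cu] Du].
  rewrite pairing0l; apply: oppr_inj; rewrite (aG j)// oppr0.
  by rewrite eq_sym (negbTE ji).
have ai1 : - pairing (a i) (p i) <= 1.
  have -> : pairing (a i) (p i) = pairing (a i) m.
    by rewrite pE pairing_sumr (bigD1 i)//= big1 ?addr0.
  rewrite mE pairing_sumr -sumrN.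
  have -> : 1 = \sum_j ((i == j)%:R : R).
    by rewrite (bigD1 i)//= eqxx big1 ?addr0// => j; rewrite eq_sym => /negbTE ->.
  apply: ler_sum => j _; apply: le_trans (check_phi_part_le hDelta hnef i (Dq j)).
  exact: support_fun_ge (nabla_part_face_neq0 D hDelta i _) (aP i).
(* The form [y + b (a i)] is nonnegative on the generators in the part, since
   [a i] takes the value [-1] there. *)
have : 0 <= pairing (y + b *: a i) (p i).
  apply: cone_ge0 (pc i) => u [[Gu Cu] Du].
  have /eqP := aG i u Gu Cu Du i; rewrite eqxx eqr_oppLR => /eqP au.
  rewrite pairingDl pairingZl au mulrN1 subr_ge0 pairingC.
  by apply: hb => //; exact: nE.
by rewrite pairingDl pairingZl pairingC; nra.
Qed.

Lemma twisted0 : hc 0 = 0.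
Proof. by have := @twisted_homogeneous 0 0 (lexx 0); rewrite scale0r mul0r. Qed.

Lemma decomposition_part n (p : 'I_r -> 'rV[R]_d) i :
  (forall y b, b <= 0 ->
      (forall u, G u -> D i u -> hc u = - pairing n u -> b <= pairing u y) ->
      b <= pairing (p i) y) -> D i (p i).
Proof.
move=> hp; apply: polytope_separation; first by case: hnef.
move=> y; have [x _ fx] := nef_part_face hDelta hnef i y.
exists x; first exact: fx.1.
apply: hp => [|u _ Du _]; last exact: fx.2.
by rewrite -(pairing0l y); apply: fx.2; exact: nef_part0 hDelta hnef _.
Qed.

(** Points of the Minkowski sum lie above the graph of [hc] by convexity.
    Conversely [hc] is additive along the decomposition, and the remaining height
    [l - hc m] can be given to any one of the parts. *)
Lemma tilde_Delta_epigraph m l : (0 < r)%N ->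
  tilde_Delta D hc (extend m l) <-> Delta m /\ hc m <= l.
Proof.
move=> r0; have [_ DE _] := hnef; split.
  move=> [q [/choice[q1 /choice[q2 hq]] mlE]].
  have [mE lE] : m = \sum_i q1 i /\ l = \sum_i q2 i.
    have E : extend m l = extend (\sum_i q1 i) (\sum_i q2 i).
      by rewrite mlE extend_sum; apply: eq_bigr => i _; case: (hq i).
    split; first by have := congr1 lsubmx E; rewrite !lsubmx_extend.
    by have := congr1 (@last_coord _ _) E; rewrite !last_extend.
  split; first by rewrite DE mE; exists q1; split=> // i; case: (hq i).
  have [V [_ _ Vt Vx]] := twisted_vertices.
  have [v /Vt hv ->] := Vx m; rewrite mE lE pairing_sumr -sumrN.
  apply: ler_sum => i _; have [_ + _] := hq i; apply: le_trans.
  by rewrite lerNl pairingC; exact: hv.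
move=> [/twisted_decomposition[n [p [mE hm hp pc]]] ml].
pose i0 := Ordinal r0.
exists (fun i => extend (p i) (hc (p i) + if i == i0 then l - hc m else 0)).
split=> [i|].
  exists (p i), (hc (p i) + if i == i0 then l - hc m else 0); split=> //.
    exact: decomposition_part (pc i).
  by rewrite lerDl; case: ifP => // _; rewrite subr_ge0.
rewrite -extend_sum -mE; congr extend.
rewrite big_split/= -big_mkcond/= big_pred1_eq.
under eq_bigr do rewrite hp.
by rewrite sumrN -pairing_sumr -mE -hm addrC subrK.
Qed.

(** By the decomposition, the minimum over the epigraph is the sum over the parts
    of minima over zero and the finitely many ray generators in the part; at each
    of these points [hc] is an integer. *)
Lemma tilde_Delta_lattice_face y s : (0 < r)%N -> 0 <= s ->
  exists2 x, lattice x & polyhedron_face (tilde_Delta D hc) (extend y s) x.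
Proof.
move=> r0 s0; have [_ DE _] := hnef.
pose F x := pairing x y + s * hc x.
have /choice[w hw] : forall i, exists w, [/\ lattice w, D i w,
    hc w \is a Num.int, F w <= 0 & forall u, G u -> D i u -> F w <= F u].
  move=> i; have /finite_seqP[g gE] : finite_set (G `&` D i).
    by apply: sub_finite_set finite_check_rays => u [].
  have [//|w wg wmin] := seq_argmax (s := 0 :: g) (fun u => - F u).
  exists w; have w0 : F w <= 0.
    have := wmin 0; rewrite inE eqxx => /(_ isT).
    by rewrite lerN2 {2}/F pairing0l twisted0 mulr0 addr0.
  have wu u : G u -> D i u -> F w <= F u.
    move=> Gu Du; have : (G `&` D i) u by [].
    by rewrite gE => ug; rewrite -lerN2; apply: wmin; rewrite inE [X in _ || X]ug orbT.
  move: wg; rewrite inE => /orP[/eqP w00|wg].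
    rewrite w00 in w0 wu *; split=> //; first exact: lattice0.
      exact: nef_part0 hDelta hnef _.
    by rewrite twisted0 rpred0.
  have [Gw Dw] : (G `&` D i) w by rewrite gE.
  have [wl _ _] := Gw; split=> //.
  have [C SC Cw] : fan_support cS w by rewrite check_complete.
  have [n nl nE] := twisted_linear SC.
  by rewrite nE// rpredN pairing_int.
exists (\sum_i extend (w i) (hc (w i))).
  by apply: lattice_sum => i; have [wl _ hl _ _] := hw i; exact: lattice_extend.
split.
  exists (fun i => extend (w i) (hc (w i))); split=> // i.
  by exists (w i), (hc (w i)); split=> //; case: (hw i).
move=> x'; rewrite -(extendK x'); set m := lsubmx x'; set l := last_coord x'.
move=> /(tilde_Delta_epigraph _ _ r0)[+ ml].
move=> /twisted_decomposition[n [p [mE hm hp pc]]].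
rewrite -extend_sum !pairing_extend.
apply: (@le_trans _ _ (pairing m y + s * hc m)); last first.
  by rewrite lerD2l [X in _ <= X]mulrC ler_wpM2l.
have -> : pairing m y + s * hc m = \sum_i pairing (p i) (y - s *: n).
  rewrite -pairing_suml -mE pairingBr pairingZr hm [pairing n m]pairingC; ring.
rewrite pairing_suml mulr_suml -big_split/=; apply: ler_sum => i _.
have [_ _ _ Fw0 Fwu] := hw i; rewrite mulrC.
apply: pc => // u Gu Du hu; have := Fwu u Gu Du; rewrite /F hu.
by rewrite pairingBr pairingZr [pairing n u]pairingC mulrN.
Qed.

End CheckSide.

(** * Recovering a complete fan from a convex function *)

Section CompleteFanInequalities.
Context {R : realType} {d : nat}.
Variables (S : set (set 'rV[R]_d)) (G : set 'rV[R]_d) (g : 'rV[R]_d -> R).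
Hypotheses (Sfan : is_fan S) (ST : fan_support S = setT).
Hypothesis SG : forall C, S C -> C = cone (G `&` C).
Hypotheses (gl : piecewise_linear S g) (gc : convex_on setT g).
Hypothesis gexp : forall C, S C -> exposed setT g C.
Implicit Types (p x u : 'rV[R]_d).

Lemma complete_lower_bound p : polyh G g p -> forall x, - pairing p x <= g x.
Proof.
move=> hp x; have [C SC Cx] : fan_support S x by rewrite ST.
have [m hm] := gl SC; rewrite hm// -subr_ge0 opprK -pairingDl.
move: (Cx); rewrite {1}(SG SC); apply: cone_ge0 => u [Gu Cu].
by rewrite pairingDl -hm// -lerBlDl sub0r lerNl; have := hp u Gu; rewrite lerNl.
Qed.

Lemma complete_act_cone p : polyh G g p ->
  act_cone G g p = [set x | g x = - pairing p x].
Proof.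
move=> hp; have lb := complete_lower_bound hp.
have gh := piecewise_linear_homogeneous Sfan ST gl.
apply/seteqP; split=> x.
  have lb' y : pairing (- p) y <= g y by rewrite pairingNl.
  have /cone_min := convex_cone_lower_bound gc gh lb'.
  move=> /(_ (active G g p)) h hx /=; rewrite -pairingNl; apply: h hx.
  by move=> u [Gu pu]; rewrite /= pairingNl pu opprK.
move=> /= gx; have [C SC Cx] : fan_support S x by rewrite ST.
have [m hm] := gl SC; move: (Cx); rewrite {1}(SG SC) => hx.
have ge0 u : (G `&` C) u -> 0 <= pairing (m + p) u.
  by move=> [Gu Cu]; rewrite pairingDl -hm// -lerBlDr sub0r.
have x0 : pairing (m + p) x = 0 by rewrite pairingDl -hm// gx addNr.
apply: cone_mono (cone_slack ge0 hx x0) => u [[Gu Cu] /= /eqP].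
by rewrite pairingDl -hm// addrC addr_eq0 => /eqP pu; split.
Qed.

(** The opposite of a point of the polyhedron is a linear lower bound of [g].  The
    set where it is attained is a linearity domain, hence lies in a cone of [S],
    of which it is a face; and every cone of [S] arises in this way. *)
Lemma complete_fan_act_fan : act_fan G g = S.
Proof.
have [Sf _ Sr SF _] := Sfan.
have gh := piecewise_linear_homogeneous Sfan ST gl.
apply/seteqP; split=> [_ [p hp <-]|C SC].
  have lb := complete_lower_bound hp; rewrite complete_act_cone//.
  have Elin : linearity_domain (fan_support S) g [set x | g x = - pairing p x].
    split; last by exists (- p) => x /=; rewrite pairingNl.
    - have lb' y : pairing (- p) y <= g y by rewrite pairingNl.
      have := convex_cone_lower_bound gc gh lb'.
      by congr convex_cone; apply/seteqP; split=> x /=; rewrite pairingNl.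
    - by rewrite ST.
  have gexp' C : S C -> exposed (fan_support S) g C by rewrite ST; exact: gexp.
  have [C SC EC] := linearity_domain_sub Sf gexp' Elin.
  have [m hm] := gl SC; apply: SF SC _; exists (m + p); split=> [x Cx|].
    by rewrite pairingDl -hm// -lerBlDr sub0r.
  apply/seteqP; split=> x.
    move=> /= gx; have Cx : C x by exact: EC.
    by split=> //=; rewrite pairingDl -hm// gx addNr.
  by move=> [Cx /= /eqP]; rewrite pairingDl -hm// addr_eq0 => /eqP.
have [p pg CE] := gexp SC; rewrite setTI in CE.
have hp : polyh G g (- p) by move=> u _; rewrite pairingNl lerN2; exact: pg.
exists (- p) => //; rewrite complete_act_cone// CE.
by apply/seteqP; split=> x /=; rewrite pairingNl opprK.
Qed.

End CompleteFanInequalities.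

(** * Lexicographic linear programs *)

Section Uniform.
Context {R : realType}.

(** Serves for denominators and for thresholds, since a positive multiple of a
    sufficient threshold is again sufficient. *)
Lemma seq_common_multiple (T : eqType) (s : seq T) (P : T -> nat -> Prop) :
  (forall x k l, (0 < l)%N -> P x k -> P x (l * k)%N) ->
  (forall x, x \in s -> exists2 k, (0 < k)%N & P x k) ->
  exists2 k, (0 < k)%N & forall x, x \in s -> P x k.
Proof.
move=> PM; elim: s => [_|a s ih hs]; first by exists 1%N.
have [|k k0 hk] := ih; first by move=> x xs; apply: hs; rewrite inE xs orbT.
have [|l l0 hl] := hs a; first by rewrite inE eqxx.
exists (k * l)%N; first by rewrite muln_gt0 k0.
move=> x; rewrite inE => /orP[/eqP->|/hk]; first exact: PM.
by rewrite mulnC; exact: PM.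
Qed.

Lemma linear_eventually_ge0 (a b : R) : 0 <= a -> (a = 0 -> 0 <= b) ->
  exists2 N, (0 < N)%N & forall n, (N <= n)%N -> 0 <= n%:R * a + b.
Proof.
rewrite le_eqVlt => /orP[/eqP <-|a0] hb.
  by exists 1%N => // n _; rewrite mulr0 add0r hb.
exists (Num.bound (`|b| / a)).+1 => // n Nn.
have h : `|b| / a < n%:R.
  apply: lt_le_trans (archi_boundP _) _; first by rewrite divr_ge0// ltW.
  by rewrite ler_nat ltnW.
move: h; rewrite ltr_pdivrMr// => h.
by have := ler_norm (- b); rewrite normrN; lra.
Qed.

End Uniform.

Section Lexicographic.
Context {R : realType} {d : nat}.
Variables (G : set 'rV[R]_d) (f c : 'rV[R]_d -> R).
Hypotheses (Gf : finite_set G) (Gl : G `<=` lattice).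
Hypothesis fint : forall u, G u -> f u \is a Num.int.
Hypothesis cint : forall u, G u -> c u \is a Num.int.
Hypothesis c0 : polyh G c !=set0.
Hypothesis lface : forall y, cone G y ->
  exists2 x, lattice x & polyhedron_face (polyh G f) y x.
Implicit Types (x y z u w p : 'rV[R]_d).

Definition combine (n m : nat) u : R := n%:R * f u + m%:R * c u.

Lemma lexicographic_duality y : cone G y -> exists x z, [/\ lattice x,
  polyh G f x, polyh (active G f x) c z, 
  exists2 k : nat, (0 < k)%N & lattice (k%:R *: z) &
  cone (active G f x `&` active G c z) y].
Proof.
move=> hy; have [x xl fx] := lface hy.
have Kf : finite_set (active G f x) by apply: sub_finite_set Gf => u [].
have Kl : active G f x `<=` lattice by move=> u [/Gl].
have Kc u : active G f x u -> c u \is a Num.int by move=> [/cint].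
have K0 : polyh (active G f x) c !=set0.
  by have [z hz] := c0; exists z => u [/hz].
have [z [hz yz zk]] := lp_duality Kf Kl Kc K0 (face_act_cone Gf Gl fint fx).
exists x, z; split=> //; first exact: fx.1.
by apply: cone_mono yz => u [[Gu xu] zu]; do 2!split.
Qed.

(** For large [n] the optima for the cost [n f + m c] are the points
    [n x + w], where [x] is optimal for [f] and [w] is optimal for [m c] among
    the forms constrained by the inequalities active at [x].  Only the set of
    inequalities active at both matters, and there are finitely many of these:
    so one multiple [m] makes every [w] integral and one threshold suffices. *)
Lemma lexicographic_uniform : exists n0 m : nat, [/\ (0 < n0)%N, (0 < m)%N &
  forall y, cone G y -> exists x w, [/\ lattice x, lattice w, polyh G f x,
    act_cone G f x y &
    forall n, (n0 <= n)%N -> polyh G (combine n m) (n%:R *: x + w) /\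
      act_cone G (combine n m) (n%:R *: x + w) y]].
Proof.
have /finite_seqP[bs bsE] := finite_subsets Gf.
pose good B k := exists x z, [/\ lattice x, polyh G f x,
  polyh (active G f x) c z, lattice (k%:R *: z) &
  B = active G f x `&` active G c z].
have [||m m0 hm] := @seq_common_multiple _ bs
    (fun B k => (exists2 k, (0 < k)%N & good B k) -> good B k).
- move=> B k l _ h /h[x [z [xl hx hz kz BE]]]; exists x, z; split=> //.
  by rewrite natrM -scalerA; apply: latticeZ => //; exact: rpred_nat.
- move=> B _; have [[k k0 hk]|nB] := pselect (exists2 k, (0 < k)%N & good B k).
    by exists k.
  by exists 1%N.
pose good2 B N := exists x w, [/\ lattice x, lattice w, polyh G f x,
  B `<=` active G f x &
  forall n, (N <= n)%N -> polyh G (combine n m) (n%:R *: x + w) /\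
    B `<=` active G (combine n m) (n%:R *: x + w)].
have [||n0 n00 hn0] := @seq_common_multiple _ bs
    (fun B N => (exists2 k, (0 < k)%N & good B k) -> good2 B N).
- move=> B k l l0 h /h[x [w [xl wl hx Bx hn]]]; exists x, w; split=> // n ln.
  by apply: hn; apply: leq_trans ln; rewrite leq_pmull.
- move=> B Bb; have [hB|nB] := pselect (exists2 k, (0 < k)%N & good B k); last first.
    by exists 1%N.
  have [x [z [xl hx hz mz BE]]] := hm B Bb hB.
  have /finite_seqP[s Gs] := Gf.
  have [||N N0 hN] := @seq_common_multiple _ s (fun u N => forall n, (N <= n)%N ->
      0 <= n%:R * (pairing x u + f u) + m%:R * (pairing z u + c u)).
  - move=> u k l l0 h n ln; apply: h; apply: leq_trans ln.
    by rewrite leq_pmull.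
  - move=> u us; have Gu : G u by rewrite Gs.
    apply: linear_eventually_ge0; first by rewrite -lerBlDr sub0r hx.
    move=> /eqP; rewrite addr_eq0 => /eqP xu.
    by rewrite mulr_ge0// -lerBlDr sub0r; apply: hz; split.
  exists N => // _; exists x, (m%:R *: z); split=> //; first by rewrite BE => u [].
  move=> n Nn; split=> [u|u].
    rewrite Gs => us; have := hN u us n Nn.
    by rewrite /combine pairingDl !pairingZl; lra.
  rewrite BE => -[[Gu xu] [_ zu]]; split=> //.
  by rewrite /combine pairingDl !pairingZl xu zu; ring.
exists n0, m; split=> // y /lexicographic_duality[x [z [xl hx hz [k k0 kz] hy]]].
set B := active G f x `&` active G c z in hy.
have [||x' [w [xl' wl hx' Bx hn]]] := hn0 B.
- have : [set A | A `<=` G] B by move=> u [[]].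
  by rewrite bsE.
- by exists k => //; exists x, z.
exists x', w; split=> //; first exact: cone_mono hy.
by move=> n /hn[h1 h2]; split=> //; exact: cone_mono hy.
Qed.

Variables (n m : nat).
Hypothesis good_pair : forall y, cone G y -> exists x w,
  [/\ lattice x, lattice w, polyh G f x, act_cone G f x y &
    forall n', (n <= n')%N -> polyh G (combine n' m) (n'%:R *: x + w) /\
      act_cone G (combine n' m) (n'%:R *: x + w) y].

Lemma combine_int k u : G u -> combine k m u \is a Num.int.
Proof.
move=> Gu; rewrite /combine; apply: rpredD; apply: rpredM; rewrite ?rpred_nat//.
  exact: fint.
exact: cint.
Qed.

Lemma combine_nonempty k : (n <= k)%N -> polyh G (combine k m) !=set0.
Proof.
move=> nk; have [x [w [_ _ _ _ /(_ k nk)[h _]]]] := good_pair (cone0 G).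
by exists (k%:R *: x + w).
Qed.

(** [C] is contained in a single cone [act_cone G f x].  At an inequality active
    for the cost with [n + 1], replacing [n + 1] by [n] subtracts the slack of [x]
    for [f] and leaves a feasible point; so that slack is zero. *)
Lemma combine_cone C : act_fan G (combine n.+1 m) C ->
  exists x p, [/\ lattice p, polyh G f x, C `<=` act_cone G f x &
    forall y, C y -> support_fun (polyh G (combine n.+1 m)) y = - pairing p y].
Proof.
move=> [q hq <-].
have [|y hy ry] := @cone_relint _ _ (active G (combine n.+1 m) q).
  by apply: sub_finite_set Gf => u [].
have [x [w [xl wl hx _ hn]]] := good_pair (act_cone_sub hy).
have [hp py] := hn n.+1 (leqnSn n).
have [hp' _] := hn n (leqnn n).
have pq u : active G (combine n.+1 m) q u ->
    active G (combine n.+1 m) (n.+1%:R *: x + w) u.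
  move=> hu; split; first exact: hu.1.
  rewrite -hu.2; apply/eqP; rewrite -subr_eq0 -pairingBl; apply/eqP.
  apply: ry hu => [v|]; first exact: active_ge0.
  have := support_act_cone hp py; rewrite (support_act_cone hq hy).
  by move=> /oppr_inj; rewrite pairingBl => ->; rewrite subrr.
exists x, (n.+1%:R *: x + w); split=> //.
- by apply: latticeD => //; apply: latticeZ => //; exact: rpred_nat.
- apply: cone_mono => u /pq[Gu h]; split=> //.
  have := hp' u Gu; have := hx u Gu; move: h.
  rewrite /combine !pairingDl !pairingZl -natr1; lra.
- move=> z hz; apply: support_act_cone => //.
  by apply: cone_mono hz; exact: pq.
Qed.

Lemma support_polyh_convex k : (n <= k)%N ->
  convex_on (cone G) (support_fun (polyh G (combine k m))).
Proof.
move=> nk y z hy hz; have kint u := @combine_int k u.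
have [p [hp pyz _]] := lp_duality Gf Gl kint (combine_nonempty nk) (coneD hy hz).
have [q hq _] := act_cone_exposed Gf Gl kint hp.
have [p1 [hp1 py _]] := lp_duality Gf Gl kint (combine_nonempty nk) hy.
have [p2 [hp2 pz _]] := lp_duality Gf Gl kint (combine_nonempty nk) hz.
rewrite (support_act_cone hp pyz) (support_act_cone hp1 py) (support_act_cone hp2 pz).
rewrite pairingDr opprD lerD// lerN2.
  exact: (act_cone_face hp1 py).2.
exact: (act_cone_face hp2 pz).2.
Qed.

(** The optima for [n] and [n + 1] differ by [x], which is optimal for [f]; so the
    difference of the support functions is the support function for [n]. *)
Lemma combine_convex : convex_on (cone G)
  (support_fun (polyh G (combine n.+1 m)) \- support_fun (polyh G f)).
Proof.
have E y : cone G y -> support_fun (polyh G (combine n.+1 m)) y -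
    support_fun (polyh G f) y = support_fun (polyh G (combine n m)) y.
  move=> /good_pair[x [w [xl wl hx xy hn]]].
  have [hp py] := hn n.+1 (leqnSn n).
  have [hp' py'] := hn n (leqnn n).
  rewrite (support_act_cone hp py) (support_act_cone hx xy).
  rewrite (support_act_cone hp' py') !pairingDl !pairingZl -natr1; ring.
by move=> y z hy hz; rewrite /= !E//; [exact: support_polyh_convex|exact: coneD].
Qed.

End Lexicographic.

(** * The generators at heights zero and one *)

Section TildeGenerators.
Context {R : realType} {d : nat}.
Variables (G0 V : set 'rV[R]_d).
Hypotheses (G0f : finite_set G0) (Vf : finite_set V).
Implicit Types (x y v m : 'rV[R]_d) (a : 'rV[R]_d -> R) (u : 'rV[R]_(d + 1)).

Definition tilde_gens : set 'rV[R]_(d + 1) :=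
  [set extend e 0 | e in G0] `|` [set extend v 1 | v in V].

(** Interpolates between [a] at height zero and zero at height one.  For the
    constant [a = 1] it gives the inequalities of [tilde_Delta]. *)
Definition cost a u : R := (1 - last_coord u) * a (lsubmx u).

Lemma cost0 a e : cost a (extend e 0) = a e.
Proof. by rewrite /cost last_extend lsubmx_extend subr0 mul1r. Qed.

Lemma cost1 a v : cost a (extend v 1) = 0.
Proof. by rewrite /cost last_extend subrr mul0r. Qed.

Lemma tilde_gens_finite : finite_set tilde_gens.
Proof. by rewrite finite_setU; split; exact: finite_image. Qed.

Lemma tilde_gens_lattice : G0 `<=` lattice -> V `<=` lattice ->
  tilde_gens `<=` lattice.
Proof.
by move=> G0l Vl _ [[e /G0l el <-]|[v /Vl vl <-]]; apply: lattice_extend;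
  rewrite ?rpred0 ?rpred1.
Qed.

Lemma cost_int a : (forall e, G0 e -> a e \is a Num.int) ->
  forall u, tilde_gens u -> cost a u \is a Num.int.
Proof.
move=> ai _ [[e /ai ei <-]|[v _ <-]]; first by rewrite cost0.
by rewrite cost1 rpred0.
Qed.

Lemma tilde_gens_last (y : 'rV[R]_(d + 1)) : cone tilde_gens y -> 0 <= last_coord y.
Proof.
elim=> [|t u z t0 uG _ ih]; first by rewrite last_coord0.
rewrite last_coordD last_coordZ addr_ge0// mulr_ge0//.
by case: uG => -[e _ <-]; rewrite last_extend.
Qed.

Lemma polyh_cost a m l : polyh tilde_gens (cost a) (extend m l) <->
  polyh G0 a m /\ forall v, V v -> 0 <= pairing m v + l.
Proof.
split=> [h|[h0 h1] _ [[e Ge <-]|[v Vv <-]]].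
- split=> [e Ge|v Vv].
    have := h (extend e 0); rewrite cost0 pairing_extend mulr0 addr0; apply.
    by left; exists e.
  have := h (extend v 1); rewrite cost1 pairing_extend mulr1 oppr0; apply.
  by right; exists v.
- by rewrite cost0 pairing_extend mulr0 addr0 h0.
- by rewrite cost1 pairing_extend mulr1 oppr0 h1.
Qed.

Lemma lift_height m : exists l, forall v, V v -> 0 < pairing m v + l.
Proof.
have /finite_seqP[s ->] := Vf.
elim: s => [|v s [l hl]]; first by exists 0.
exists (Num.max l (1 - pairing m v)) => w /=; rewrite inE => /orP[/eqP ->|ws].
  by rewrite -ltrBlDl sub0r lt_max; apply/orP; right; lra.
by apply: lt_le_trans (hl w ws) _; rewrite lerD2l le_max lexx.
Qed.

(** A combination of generators that has height zero involves no generator of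
    height one. *)
Lemma slice0_act_cone a m l :
  slice0 (act_cone tilde_gens (cost a) (extend m l)) = act_cone G0 a m.
Proof.
apply/seteqP; split=> y hy.
  have G_ge0 u : active tilde_gens (cost a) (extend m l) u ->
      0 <= pairing (extend 0 1) u.
    by move=> [[[e _ <-]|[v _ <-]] _]; rewrite pairing_extend pairing0l add0r.
  have y0 : pairing (extend 0 1) (extend y 0) = 0.
    by rewrite pairing_extend pairing0l mulr0 addr0.
  have := cone_slack G_ge0 hy y0; rewrite -{2}(lsubmx_extend y 0).
  apply: (@cone_linear _ _ _ (@lsubmx _ 1 d 1)).
  - by move=> t u x; rewrite linearP.
  - exact: linear0.
  - move=> _ [[[[e Ge <-]|[v _ <-]] h] /=]; rewrite pairing_extend pairing0l.
      move=> _; rewrite lsubmx_extend; apply: cone_gen; split=> //.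
      by move: h; rewrite cost0 pairing_extend mulr0 addr0.
    by rewrite add0r mulr1 => /eqP; rewrite oner_eq0.
apply: (cone_linear (f := fun y => extend y 0)) hy => [t u x||e [Ge h]].
- by rewrite -extendZ -extendD mulr0 addr0.
- exact: extend00.
- apply: cone_gen; split; first by left; exists e.
  by rewrite cost0 pairing_extend mulr0 addr0.
Qed.

Lemma slice0_act_fan a :
  [set slice0 C | C in act_fan tilde_gens (cost a)] = act_fan G0 a.
Proof.
apply/seteqP; split=> [_ [_ [x hx <-] <-]|_ [m hm <-]].
  move: hx; rewrite -(extendK x) => /polyh_cost[hx _].
  by rewrite slice0_act_cone; exists (lsubmx x).
have [l hl] := lift_height m.
exists (act_cone tilde_gens (cost a) (extend m l)); last exact: slice0_act_cone.
by exists (extend m l) => //; apply/polyh_cost; split=> // v /hl/ltW.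
Qed.

Lemma support_level0 a m y : polyh G0 a m -> act_cone G0 a m y ->
  support_fun (polyh tilde_gens (cost a)) (extend y 0) = - pairing m y.
Proof.
move=> hm hy; have [l hl] := lift_height m.
rewrite (@support_act_cone _ _ _ _ (extend m l)).
- by rewrite pairing_extend mulr0 addr0.
- by apply/polyh_cost; split=> // v /hl/ltW.
- by move: hy; rewrite -(slice0_act_cone a m l).
Qed.

Lemma act_fan_ray c C : act_fan tilde_gens c C -> is_ray C -> ~ C `<=` level0 ->
  exists2 v, V v & C = ray (extend v 1).
Proof.
move=> [x _ <-] [e e0 CE] nC.
have [u [[xa ux] u1]] : exists u, active tilde_gens c x u /\ last_coord u <> 0.
  apply: contrapT => /forallNP h; apply: nC => y hy.
  have y0 : last_coord y = 0.
    elim: hy => [|t u z _ ua _ ih]; first by rewrite last_coord0.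
    rewrite last_coordD last_coordZ ih addr0.
    have -> : last_coord u = 0; last by rewrite mulr0.
    by apply: contrapT => u0; apply: (h u).
  by exists (lsubmx y) => //; rewrite -y0 extendK.
case: xa => -[v Vv uE]; first by rewrite -uE last_extend in u1.
have ua : active tilde_gens c x u by split=> //; right; exists v.
exists v => //; rewrite uE CE; apply/esym.
have [t t0 tE] : ray e u by rewrite -CE; exact: cone_gen.
apply: (ray_eq _ tE); rewrite lt0r t0 andbT; apply/eqP => t00.
by apply: u1; rewrite tE t00 scale0r last_coord0.
Qed.

Lemma primitive_extend1 v : lattice v -> primitive (extend v 1).
Proof.
move=> vl; split; first by apply: lattice_extend => //; exact: rpred1.
  move=> v0; have := last_extend v 1; rewrite v0 last_coord0 => /eqP.
  by rewrite eq_sym oner_eq0.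
move=> k u ul vE; have := last_extend v 1.
rewrite vE -scaler_nat last_coordZ; apply: int_mul_nat_eq1.
exact: lattice_last.
Qed.

End TildeGenerators.

Lemma act_fan_ext (R : realType) (d : nat) (G : set 'rV[R]_d)
    (c c' : 'rV[R]_d -> R) : (forall u, G u -> c u = c' u) ->
  act_fan G c = act_fan G c'.
Proof.
move=> cc'; have pE : polyh G c = polyh G c'.
  by apply/seteqP; split=> x hx u Gu; [rewrite -cc'//|rewrite cc'//]; exact: hx.
have aE x : active G c x = active G c' x.
  by apply/seteqP; split=> u [Gu xu]; split; rewrite // xu cc'.
rewrite /act_fan pE; congr image; apply/funext => x.
by rewrite /act_cone aE.
Qed.

(** * Good data *)

Theorem theorem3p26 (R : realType) (d r : nat) (hr : (0 < r)%N)
    (Delta : set 'rV[R]_d) (D : 'I_r -> set 'rV[R]_d)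
    (hDelta : reflexive_polytope Delta) (hnef : nef_partition Delta D)
    (phi : 'rV[R]_d -> R)
    (hphi : piecewise_linear (normal_fan Delta) phi)
    (hphi1 : forall e, ray_generators (normal_fan Delta) e -> phi e = 1)
    (Sigma' cSigma' : set (set 'rV[R]_d))
    (hSigma' :
      partial_crepant_resolution (polar Delta) (normal_fan Delta) Sigma')
    (hcSigma' :
      partial_crepant_resolution (polar (nabla Delta D))
        (normal_fan (nabla Delta D)) cSigma')
    (h ch : 'rV[R]_d -> R)
    (hh : integral_piecewise_linear Sigma' h)
    (hch : integral_piecewise_linear cSigma' ch)
    (hhconv : strictly_convex Sigma' h)
    (hchconv : strictly_convex cSigma' ch)
    (hh' : convex_on setT (h \- phi))
    (hch' : convex_on setT (ch \- check_phi Delta D)) :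
  exists n0 m0 : nat, [/\ (0 < n0)%N, (0 < m0)%N &
    forall n : nat, (n0 <= n)%N ->
      exists (tSigma' : set (set 'rV[R]_(d + 1))) (th : 'rV[R]_(d + 1) -> R),
        good_data D (ch \- check_phi Delta D) phi Sigma'
          (fun y => m0%:R * h y + n%:R * phi y) tSigma' th].
Proof.
have phiE := support_fun_unique hDelta hphi hphi1.
have [[Sfan _ _] _] := hSigma'; have [Sf _ Sr SF _] := Sfan.
have ST := subdivision_complete hDelta hSigma'.
have Spoint := subdivision_point hDelta hSigma'.
have Sgen := subdivision_rays hDelta hSigma'.
have Sineq := subdivision_inequalities hDelta hSigma'.
rewrite -phiE in Sgen Sineq.
have phic : convex_on setT phi.
  by rewrite phiE; apply: support_fun_convex; exact: reflexive_face_neq0.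
have hpl : piecewise_linear Sigma' h.
  by move=> C /hh[m _ hm]; exists m.
have hexp := complete_fan_exposed Sfan ST hpl hhconv.
have hc : convex_on setT h by case: hhconv; rewrite ST.
have [V [Vf Vl Vt Vx]] := twisted_vertices hDelta hcSigma' hch hch'.
pose G0 := unit_rays phi Sigma'.
have G0f : finite_set G0.
  apply: finite_unit_rays => //; rewrite phiE; exact: reflexive_homogeneous.
have G0l : G0 `<=` lattice by move=> e [].
have hint e : G0 e -> h e \is a Num.int.
  move=> [el _ /hh[m ml hm]]; rewrite hm; first exact: pairing_int.
  by exists 1; rewrite ?scale1r.
pose G := tilde_gens G0 V.
have Gf : finite_set G := tilde_gens_finite G0f Vf.
have Gl : G `<=` lattice := tilde_gens_lattice G0l Vl.
pose f := cost (fun=> 1 : R) : 'rV[R]_(d + 1) -> R.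
pose c := cost h.
have fint u : G u -> f u \is a Num.int by apply: cost_int => e _; exact: rpred1.
have cint u : G u -> c u \is a Num.int by exact: cost_int.
(* The inequalities at height zero cut out [Delta], those at height one the
   epigraph of the twisted function. *)
have tE : tilde_Delta D (ch \- check_phi Delta D) = polyh G f.
  apply/seteqP; split=> x; rewrite -(extendK x).
    move=> /(tilde_Delta_epigraph hDelta hnef hcSigma' hch hch' _ _ hr)[Dm ml].
    apply/polyh_cost; split=> [e [_ e1 _]|v /Vt hv].
      rewrite -e1 phiE lerNl.
      exact: support_fun_ge (reflexive_face_neq0 hDelta _) Dm.
    by have := hv (lsubmx x); lra.
  move=> /polyh_cost[h0 h1].
  apply/(tilde_Delta_epigraph hDelta hnef hcSigma' hch hch' _ _ hr).
  split; first exact: Sineq.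
  have [v Vv ->] := Vx (lsubmx x).
  by have := h1 v Vv; rewrite pairingC; lra.
have lface y : cone G y -> exists2 x, lattice x & polyhedron_face (polyh G f) y x.
  move=> /tilde_gens_last y0; rewrite -tE -(extendK y).
  exact: (tilde_Delta_lattice_face hDelta hnef hcSigma' hch hch' _ hr y0).
have [p0 hp0] : exists p, forall x, pairing p x <= h x.
  have [C SC _] : fan_support Sigma' 0 by rewrite ST.
  by have [p hp _] := hexp C SC; exists p => x; exact: hp.
have c0 : polyh G c !=set0.
  have [l hl] := lift_height Vf (- p0); exists (extend (- p0) l).
  apply/polyh_cost; split=> [e _|v /hl/ltW //].
  by rewrite pairingNl lerN2.
have [n0 [m0 [n00 m00 pairs]]] := lexicographic_uniform Gf Gl fint cint c0 lface.
(* The threshold is raised by one so that the data also exist for [n - 1]. *)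
exists n0.+1, m0; split=> // -[//|n] n0n.
have {}pairs y : cone G y -> exists x w,
  [/\ lattice x, lattice w, polyh G f x, act_cone G f x y &
    forall n', (n <= n')%N -> polyh G (combine f c n' m0) (n'%:R *: x + w) /\
      act_cone G (combine f c n' m0) (n'%:R *: x + w) y].
  move=> /pairs[x [w [xl wl hx xy hn]]]; exists x, w; split=> // n' nn'.
  by apply: hn; exact: leq_trans nn'.
pose g y := m0%:R * h y + n.+1%:R * phi y.
pose a := fun u : 'rV[R]_d => n.+1%:R * 1 + m0%:R * h u.
have aE : combine f c n.+1 m0 = cost a.
  by apply/funext => u; rewrite /combine /f /c /cost /a; ring.
have ag e : G0 e -> a e = g e.
  by move=> [_ e1 _]; rewrite /a /g e1; ring.
have m0R : 0 < m0%:R :> R by rewrite ltr0n.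
have nR : 0 < n.+1%:R :> R by rewrite ltr0n.
have gpl C : Sigma' C -> exists2 m, lattice m & forall x, C x -> g x = pairing m x.
  move=> SC; have [m ml hm] := hh C SC; have [x xl fx] := Spoint C SC.
  exists (m0%:R *: m - n.+1%:R *: x).
    by apply: latticeD; [|apply: latticeN]; apply: latticeZ => //; exact: rpred_nat.
  move=> y Cy; rewrite /g hm// phiE (support_fun_face (fx y Cy)).
  by rewrite pairingBl !pairingZl; ring.
have gpl' : piecewise_linear Sigma' g by move=> C /gpl[m _ hm]; exists m.
have gc : convex_on setT g.
  by move=> x y _ _; have := hc x y I I; have := phic x y I I; rewrite /g; nra.
have gexp C : Sigma' C -> exposed setT g C.
  move=> SC; have [p hp CE] := hexp C SC; have [x _ fx] := Spoint C SC.
  have [y0 Cy0] : C !=set0.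
    by exists 0; have [] := rational_cone_convex (Sr C SC).1.
  have phix y : - pairing x y <= phi y.
    by rewrite phiE; apply: support_fun_ge (reflexive_face_neq0 hDelta _) (fx y0 Cy0).1.
  exists (m0%:R *: p - n.+1%:R *: x) => [y _|].
    have := hp y I; have := phix y; rewrite /g pairingBl !pairingZl; nra.
  rewrite setTI in CE; rewrite setTI; apply/seteqP; split=> y.
    move=> Cy; have := Cy; rewrite {1}CE /= /g => ->.
    by rewrite phiE (support_fun_face (fx y Cy)) pairingBl !pairingZl; ring.
  rewrite CE /= /g pairingBl !pairingZl.
  have := hp y I; have := phix y; nra.
have SA : act_fan G0 g = Sigma' := complete_fan_act_fan Sfan ST Sgen gpl' gc gexp.
have cn_int u : G u -> combine f c n.+1 m0 u \is a Num.int.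
  exact: combine_int.
have cn0 := combine_nonempty pairs (leqnSn n).
have suppE := fan_support_act_fan Gf Gl cn_int cn0.
have [l hl] := lift_height Vf (- (m0%:R *: p0)).
(* The point over [- m0 p0] is strictly feasible: at height zero because the
   coefficient of [phi] is positive, at height one because [l] is large. *)
have tfan : is_fan (act_fan G (combine f c n.+1 m0)).
  apply: (act_fan_is_fan (q := extend (- (m0%:R *: p0)) l)) => // u.
  rewrite aE => -[[e Ge <-]|[v Vv <-]].
    rewrite cost0 pairing_extend mulr0 addr0 pairingNl pairingZl /a.
    by have := hp0 e; nra.
  by rewrite cost1 pairing_extend mulr1 oppr0 hl.
have f0 : polyh G f !=set0.
  by have [x [w [_ _ hx _ _]]] := pairs 0 (cone0 G); exists x.
exists (act_fan G (combine f c n.+1 m0)),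
  (support_fun (polyh G (combine f c n.+1 m0))).
rewrite -/g; split.
  split=> //.
    apply: exposed_strictly_convex => //; rewrite ST; last exact: gexp.
    by split.
  move=> x y _ _ /=; have := hc x y I I; have := phic x y I I.
  rewrite /g -natr1 => h1 h2; have := ler0n R n; nra.
split.
- split.
  + rewrite tE normal_fan_polyh//; split=> //.
      by rewrite suppE fan_support_act_fan.
    move=> C /(combine_cone Gf pairs)[x [p [_ hx Cx _]]].
    by exists (act_cone G f x) => //; exists x.
  + by rewrite aE slice0_act_fan// -SA; exact: act_fan_ext.
  + move=> C SC rC nC; have [v Vv ->] := act_fan_ray SC rC nC.
    by exists v; split=> //; [apply: primitive_extend1; exact: Vl|exact: Vt].
- move=> C /(combine_cone Gf pairs)[x [p [pl _ _ Cp]]]; exists (- p).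
    exact: latticeN.
  by move=> y Cy; rewrite pairingNl Cp.
- move=> y; have [C SC Cy] : fan_support Sigma' y by rewrite ST.
  move: (SC); rewrite -SA => -[m hm CE]; rewrite -CE in Cy.
  have := Cy; rewrite (complete_act_cone Sfan ST Sgen gpl' gc hm) => /= ->.
  have hm' : polyh G0 a m by move=> e Ge; rewrite ag//; exact: hm.
  rewrite aE; apply: support_level0 => //.
  apply: cone_mono Cy => e [Ge he]; split=> //.
  by rewrite he ag.
- apply: exposed_strictly_convex => //; rewrite suppE; first exact: convex_cone_cone.
  by move=> _ [x hx <-]; exact: act_cone_exposed.
- rewrite suppE tE; exact: combine_convex.
Qed.
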